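(* For $n,m\in\mathbb{N}$ let $kr_1(n,m)$ denote the number of partitions $\lambda_1\le\lambda_2\le\cdots\le\lambda_m$ of $n$ into $m$ parts satisfying: (a) no consecutive parts are allowed (i.e. no two parts are consecutive integers $k,k+1$); (b) odd parts do not repeat; (c) for every contiguous sub-partition $\lambda_i+\lambda_{i+1}+\lambda_{i+2}$, we have $|\lambda_i-\lambda_{i+2}|\ge4$ if $\lambda_{i+1}$ is even and appears more than once; (d) $2+2$ is not allowed as a sub-partition. Then $$\begin{aligned}&\sum_{m,n\ge0}kr_1(n,m)q^nt^m\\&=\sum_{\substack{m_1,m_2,m_3,\\ m,n_{12},i,j,k\ge0}}\frac{P(m_1,m_2,m_3,m+1;q^2)\,q^{2mn_{12}+2n_{12}^2+i+4j+(2m_1+2m_2+5m_3+n_{12}+i+2j+k)^2}}{(q^2;q^2)_{n_{12}}(q^6;q^6)_{m_1+m_2+2m_3}(q^2;q^2)_i(q^4;q^4)_j}\,t^{2m_1+2m_2+5m_3+n_{12}+i+2j+k},\end{aligned}$$ where the $P(m_1,m_2,m_3,m+1;q)$ are the polynomials in $q$ with (evidently) nonnegative coefficients defined in the context. Moreover, the right-hand side is an evidently positive series, i.e. every summand has nonnegative coefficients as a power series in $q$ and $t$.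
   Context: A partition is a finite nondecreasing sequence of positive integers (possibly empty); its weight is the sum of its parts. $|q|<1$ (or: identities of formal power series). $(a;q)_0=1$, $(a;q)_n=(1-a)(1-aq)\cdots(1-aq^{n-1})$. The polynomials $P$. The following notions concern partitions in which each part appears at most twice. Pairs and singletons. Read the parts $\lambda_1\le\lambda_2\le\cdots$ from left to right: at the current part $\lambda_i$, if $\lambda_{i+1}$ exists and $\lambda_{i+1}-\lambda_i\in\{0,1\}$, then $[\lambda_i,\lambda_{i+1}]$ is declared a pair and one continues with $\lambda_{i+2}$; otherwise $\lambda_i$ is declared a singleton and one continues with $\lambda_{i+1}$. So each pair is a pair of repeating parts $[k,k]$ or a pair of consecutive parts $[k,k+1]$. Backward moves on pairs. A backward move on a pair replaces $[k,k+1]$ by $[k-1,k-1]$, or $[k,k]$ by $[k-2,k-1]$ (after which the parts are re-sorted and pairs are determined anew). It is possible only if all parts of the result are positive, each part of the result appears at most twice, and the pair is not moved through another pair, i.e. the smaller part of the moved pair is at least the larger part of the immediately preceding pair (if there is one). Base partitions. A base partition is a partition $\beta$ with each part appearing at most twice such that (i) no backward move is possible on any pair of $\beta$; (ii) the singletons located after the last (largest) pair (all singletons, if there are no pairs) are exactly $k+1,k+3,\dots,k+2n_{12}-1$ for some $n_{12}\ge0$, where the largest pair is $[k,k]$ or $[k,k+1]$, and $k=0$ if there are no pairs. The singletons in (ii) are called moveable; the other singletons, lying between pairs, are called immobile. Blocks. A block of a base partition is a group of five parts of the form $[k-1,k],k,[k+2,k+2]$ (two successive pairs with an immobile singleton $k$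 between them). Definition of $P$. For $m_1,m_2,m_3\in\mathbb{N}$ not all zero and $m\in\mathbb{Z}$, $P(m_1,m_2,m_3,m+1;q)=\sum_\beta q^{w(\beta)}$, the sum over base partitions $\beta$ without moveable singletons having exactly $m_3$ blocks, $m_1$ pairs of repeating parts not contained in blocks, and $m_2$ pairs of consecutive parts not contained in blocks, and whose largest pair is $[m,m]$ or $[m,m+1]$; $w(\beta)$ is the weight. Also $P(0,0,0,1;q)=1$ and $P(0,0,0,m+1;q)=0$ for $m\ne0$. $P(\cdots;q^2)$ means $q$ replaced by $q^2$. *)

(* Defs.v *)
From mathcomp Require Import all_boot all_order all_algebra.
Set Implicit Arguments.
Unset Strict Implicit.
Unset Printing Implicit Defensive.

Import GRing.Theory Num.Theory.

Definition is_partition (l : seq nat) : bool := sorted leq l && (0 \notin l).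

Definition no_consecutive_parts (l : seq nat) : bool :=
  all (fun x => x.+1 \notin l) l.

Definition odd_parts_distinct (l : seq nat) : bool :=
  all (fun x => odd x ==> (count_mem x l <= 1)) l.

Definition gap_around_repeated_even (l : seq nat) : bool :=
  all (fun i =>
         let y := nth 0 l i.+1 in
         ~~ odd y && (1 < count_mem y l) ==>
         (4 <= `|Posz (nth 0 l i) - Posz (nth 0 l i.+2)|%N))
      (iota 0 (size l - 2)).

Definition no_two_plus_two (l : seq nat) : bool := count_mem 2 l < 2.

Definition kr1_partition (l : seq nat) : bool :=
  [&& is_partition l, no_consecutive_parts l, odd_parts_distinct l,
      gap_around_repeated_even l & no_two_plus_two l].

(* The parts of a partition of n are at most n, so m-tuples over 'I_n.+1 give
   all the partitions of n into m parts. *)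
Definition kr1 (n m : nat) : nat :=
  #|[set l : m.-tuple 'I_n.+1 | let s := map val l in
      (sumn s == n) && kr1_partition s]|.

(* The left-to-right decomposition of a partition: a group of size 2 is a pair,
   a group of size 1 is a singleton. *)
Fixpoint groups (l : seq nat) : seq (seq nat) :=
  match l with
  | a :: (b :: l'') as l' =>
      if (b == a) || (b == a.+1) then [:: a; b] :: groups l''
      else [:: a] :: groups l'
  | [:: a] => [:: [:: a]]
  | [::] => [::]
  end.

Definition is_pair (g : seq nat) : bool := size g == 2.
Definition is_repeating (g : seq nat) : bool :=
  is_pair g && (nth 0 g 1 == nth 0 g 0).
Definition is_successive (g : seq nat) : bool :=
  is_pair g && (nth 0 g 1 == (nth 0 g 0).+1).

Definition moved_pair (g : seq nat) : seq nat :=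
  let k := nth 0 g 0 in
  if is_repeating g then [:: k - 2; k - 1] else [:: k - 1; k - 1].

Definition at_most_twice (l : seq nat) : bool :=
  all (fun x => count_mem x l <= 2) l.

(* Whether a backward move is possible on the i-th group of s, assumed to be a
   pair.  The truncated subtractions in moved_pair yield 0 exactly when the
   true result has a nonpositive part.  The default [:: 0; 0] stands for the
   absence of a preceding pair.  Since only multiplicities matter here, the
   result of the move is not re-sorted. *)
Definition backward_movable (s : seq (seq nat)) (i : nat) : bool :=
  let g := moved_pair (nth [::] s i) in
  let result := flatten (take i s) ++ g ++ flatten (drop i.+1 s) in
  let preceding := last [:: 0; 0] (filter is_pair (take i s)) in
  [&& 0 \notin g, at_most_twice result & nth 0 preceding 1 <= nth 0 g 0].

Definition no_backward_move (s : seq (seq nat)) : bool :=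
  all (fun i => is_pair (nth [::] s i) ==> ~~ backward_movable s i)
      (iota 0 (size s)).

(* The smaller part of the largest pair, 0 if there are no pairs. *)
Definition last_pair_part (s : seq (seq nat)) : nat :=
  nth 0 (last [::] (filter is_pair s)) 0.

(* The singletons after the last pair (all of them if there are no pairs). *)
Definition moveable_singletons (s : seq (seq nat)) : seq nat :=
  flatten (rev (take (find is_pair (rev s)) (rev s))).

Definition is_base (b : seq nat) : bool :=
  let s := groups b in
  let sg := moveable_singletons s in
  [&& is_partition b, at_most_twice b, no_backward_move s
    & sg == [seq last_pair_part s + 2 * i + 1 | i <- iota 0 (size sg)]].

(* The groups number i, i+1, i+2 form a block [k-1,k], k, [k+2,k+2]. *)
Definition is_block (s : seq (seq nat)) (i : nat) : bool :=
  let a := nth 0 (nth [::] s i) 0 in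
  take 3 (drop i s) == [:: [:: a; a.+1]; [:: a.+1]; [:: a.+3; a.+3]].

Definition in_block (s : seq (seq nat)) (i : nat) : bool :=
  has (fun j => is_block s j && (j <= i <= j + 2)) (iota 0 (size s)).

Definition block_count (s : seq (seq nat)) : nat :=
  count (is_block s) (iota 0 (size s)).
Definition free_repeating_count (s : seq (seq nat)) : nat :=
  count (fun i => is_repeating (nth [::] s i) && ~~ in_block s i)
        (iota 0 (size s)).
Definition free_successive_count (s : seq (seq nat)) : nat :=
  count (fun i => is_successive (nth [::] s i) && ~~ in_block s i)
        (iota 0 (size s)).

Definition P_base (m1 m2 m3 m : nat) (b : seq nat) : bool :=
  let s := groups b in
  [&& is_base b, moveable_singletons s == [::],
      block_count s == m3, free_repeating_count s == m1,
      free_successive_count s == m2, has is_pair s & last_pair_part s == m].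

Lemma P_base_bound (m1 m2 m3 m : nat) (b : seq nat) :
  P_base m1 m2 m3 m b -> all (leq^~ m.+1) b && (size b <= 2 * m.+1).
Proof.
have flattenG l : flatten (groups l) = l.
  have [n] := ubnP (size l); elim: n l => // n IHn [|a [|c l]] //= szl.
  case: ifP => _ /=; first by rewrite IHn // -ltnS (leq_trans _ szl).
  by rewrite (IHn (c :: l)).
have shapeG l g : g \in groups l ->
    exists a, g = [:: a] \/ g = [:: a; a] \/ g = [:: a; a.+1].
  have [n] := ubnP (size l); elim: n l => // n IHn [|a [|c l]] //= szl.
    by rewrite inE => /eqP->; exists a; left.
  case: ifP => [/orP[] /eqP-> | _]; rewrite inE => /orP[/eqP->|].
  - by exists a; right; left.
  - by apply: IHn; rewrite -ltnS (leq_trans _ szl).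
  - by exists a; right; right.
  - by apply: IHn; rewrite -ltnS (leq_trans _ szl).
  - by exists a; left.
  - exact: (IHn (c :: l)).
case/and5P=> /and4P[/andP[sort_b b0] b2 _ _] /eqP mov0 _ _ /and3P[_ hasp /eqP km].
have [s' [g Es]] : exists s' g, groups b = rcons s' g.
  by case/lastP: (groups b) hasp => // s' g _; exists s', g.
have gG : g \in groups b by rewrite Es mem_rcons mem_head.
have [a Eg] := shapeG _ _ gG.
have pg : is_pair g.
  move: mov0; rewrite /moveable_singletons Es rev_rcons /=.
  case: ifP => //= _; rewrite rev_cons flatten_rcons => /(congr1 size).
  by rewrite size_cat; case: Eg => [->|[]->] //=; rewrite addnS.
have Ea : a = m.
  move: km; rewrite /last_pair_part Es filter_rcons pg last_rcons.
  by case: Eg pg => [->|[]->].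
have ble : all (leq^~ m.+1) b.
  have lastb : last 0 b <= m.+1.
    rewrite -(flattenG b) Es flatten_rcons last_cat.
    by case: Eg pg => [->|[]->] //= _; rewrite Ea.
  apply/allP=> x /(nthP 0)[i lti <-].
  apply: leq_trans lastb; rewrite -nth_last.
  apply: (sorted_leq_nth leq_trans leqnn 0 sort_b); rewrite ?inE //.
    by case: (size b) lti.
  by case: (size b) lti.
rewrite ble /=.
have cnt k : count (leq^~ k) b <= 2 * k.
  elim: k => [|k IHk].
    rewrite leqn0 -leqn0 leqNgt -has_count; apply: contra b0 => /hasP[x xb].
    by rewrite leqn0 => /eqP <-.
  have -> : count (leq^~ k.+1) b = count (leq^~ k) b + count_mem k.+1 b.
    rewrite -count_predUI -[LHS]addn0; congr (_ + _).
      by apply: eq_count => x /=; rewrite leq_eqVlt ltnS orbC.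
    rewrite -(count_pred0 b); apply: eq_count => x /=.
    by case: (x =P k.+1) => [->|]; rewrite ?ltnn ?andbF.
  have: count_mem k.+1 b <= 2.
    have [kb|/count_memPn->] := boolP (k.+1 \in b) => //.
    exact: (allP b2).
  by move=> c2; rewrite mulnS addnC leq_add.
by move: ble; rewrite all_count => /eqP <-; apply: cnt.
Qed.

Local Open Scope ring_scope.

(* The polynomials are in the variable q = 'X.  When the largest pair is [m,m]
   or [m,m+1] and no singleton follows it, the parts are at most m+1, each used
   at most twice, so the sum below is over all the relevant base partitions
   (lemma P_base_bound).  The last argument r stands for m+1. *)
Definition P (m1 m2 m3 : nat) (r : int) : {poly int} :=
  if [&& m1 == 0, m2 == 0 & m3 == 0]%N then (if r == 1 then 1 else 0)
  else if r - 1 is Posz m then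
    \sum_(b : {bseq (2 * m.+1)%N of 'I_m.+2} | P_base m1 m2 m3 m (map val b))
       'X^(sumn (map val b))
  else 0.

(* (a; q)_n *)
Definition qpoch (a q : {poly int}) (n : nat) : {poly int} :=
  \prod_(i < n) (1 - a * q ^+ i).

(* The coefficient of q^n in p/d = \sum_k p (1-d)^k in Z[[q]], for d with
   constant coefficient 1; the terms with k > n contribute nothing. *)
Definition ps_div (p d : {poly int}) (n : nat) : int :=
  (p * \sum_(k < n.+1) (1 - d) ^+ k)`_n.

Lemma ps_divP (p d : {poly int}) (n : nat) : d`_0 = 1 ->
  \sum_(i < n.+1) d`_i * ps_div p d (n - i) = p`_n.
Proof.
move=> d0; pose e := 1 - d.
have [f Ef] : exists f, e = f * 'X.
  exists (drop_poly 1 e); rewrite -[LHS](poly_take_drop 1) expr1.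
  have -> : take_poly 1 e = 0; last by rewrite add0r.
  apply/polyP=> i; rewrite coef_take_poly coef0 ltnS leqn0.
  by case: eqP => // ->; rewrite /e coefB coef1 d0 subrr.
have eX k j r : (j < k)%N -> (r * e ^+ k)`_j = 0.
  by move=> ltjk; rewrite Ef exprMn mulrA coefMXn ltjk.
have EQ j : (j <= n)%N -> ps_div p d j = (p * \sum_(k < n.+1) e ^+ k)`_j.
  move=> lejn; rewrite /ps_div !mulr_sumr !coef_sum.
  rewrite -(big_mkord xpredT (fun k => (p * e ^+ k)`_j)).
  rewrite -(big_mkord xpredT (fun k => (p * e ^+ k)`_j)) /=.
  rewrite (@big_cat_nat _ _ _ j.+1 0 n.+1) //=.
  rewrite [X in _ + X]big_nat_cond [X in _ + X]big1 ?addr0 // => k.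
  by rewrite andbT => /andP[ltjk _]; apply: eX.
under eq_bigr => i _ do rewrite EQ ?leq_subr //.
rewrite -coefM mulrCA.
have -> : d * \sum_(k < n.+1) e ^+ k = 1 - e ^+ n.+1.
  by rewrite -opprB subrX1 -mulNr opprB /e subKr.
by rewrite mulrBr mulr1 coefB eX // subr0.
Qed.

(* A formal power series in q and t is given by its coefficients: f n N is the
   coefficient of q^n t^N. *)
Definition series_qt := nat -> nat -> int.

Definition mul_tpow (f : nat -> int) (e : nat) : series_qt :=
  fun n N => if N == e then f n else 0.

(* The family F of formal power series is summable, with sum f: for each
   coefficient only finitely many members contribute, and these add up. *)
Definition formal_sum (I : eqType) (F : I -> series_qt) (f : series_qt) : Prop :=
  forall n N : nat, exists s : seq I,
    [/\ uniq s, forall x, x \notin s -> F x n N = 0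
      & \sum_(x <- s) F x n N = f n N].

Definition summand (m1 m2 m3 m n12 i j k : nat) : series_qt :=
  let N := (2 * m1 + 2 * m2 + 5 * m3 + n12 + i + 2 * j + k)%N in
  mul_tpow
    (ps_div
       ((P m1 m2 m3 (m%:Z + 1) \Po 'X^2) *
        'X^(2 * m * n12 + 2 * n12 ^ 2 + i + 4 * j + N ^ 2))
       (qpoch 'X^2 'X^2 n12 * qpoch 'X^6 'X^6 (m1 + m2 + 2 * m3) *
        qpoch 'X^2 'X^2 i * qpoch 'X^4 'X^4 j))
    N.

(* Main.v *)
Require Import Defs.
From mathcomp Require Import all_boot all_order all_algebra.
From mathcomp Require Import ring zify.
Set Implicit Arguments.
Unset Strict Implicit.
Unset Printing Implicit Defensive.
Import Order.TTheory GRing.Theory Num.Theory.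
Local Open Scope ring_scope.

(** Fix the number N of parts, that is, the power of t.  The coefficient of t^N
on either side is a series in q that expands a rational function, so the whole
argument takes place in the field of fractions, by recurrences in N; [represents]
relates a series to its fraction.  A sequence f is thought of as the series
sum_n f(n) z^n: then [lag k] is multiplication by z^k, scaling f(n) by a^n
replaces z by a z, and a functional equation in z becomes a recurrence.

The right-hand side.  Write q for q^2 in this paragraph.  Let H_M be the sum of
P(m1,m2,m3,m+1;q) q^(m n12 + n12^2) / ((q;q)_n12 (q^3;q^3)_(m1+m2+2m3)) over
2 m1 + 2 m2 + 5 m3 + n12 = M.  The heart of the matter is that H(z) = sum_M H_M z^M
equals prod_(n >= 1) (1 + z q^n + z^2 q^(2n)), the series of the partitions with
no part repeated more than twice; in the form H(z) = (1 + z q + z^2 q^2) H(z q) this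
is [twice_gf_rec].  Record a pair by the sum of its two parts: [k,k] is 2k and
[k,k+1] is 2k+1.  Starting from 0, the successive sums of a base partition without
moveable singletons increase by 2, 3 or 4, or by 5 from an odd sum, the last case
being a block, and conversely every such walk is a base partition
([walk_of_groups], [walk_immovable]); so P is a sum over walks ([P_walks]).
Let h_p and e_p be the series of the walks of p steps from 0 and from 1, completed
by moveable singletons and divided by (q^3;q^3)_p.  Splitting off the first step,
and replacing z by z q when a walk is translated by 2, expresses
(1 - q^(3p)) h_p and (1 - q^(3p)) e_p by h_(p-1) and e_(p-1).  On the other hand, if
h_p counts the partitions with parts repeated at most twice and p pairs, then
removing the parts equal to 1, or a first pair [1,2], must give
  h_p(z) = h_p(zq) + z q h_p(zq^2) + z^2 q^2 h_(p-1)(zq) + z^2 q^3 e_(p-1)(zq),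
  e_p(z) = h_p(z) - z^2 q^2 h_(p-1)(zq).
Here e_p counts those where 1 is not repeated.  [pair_recurrence_step] derives these
equations from the former ones by induction on p.  Summing over p gives the equation of H.

With q restored, the coefficient of t^N on the right is q^(N^2) times that of z^N in
H(z; q^2) / ((zq;q^2)_oo (z^2q^4;q^4)_oo (1 - z)) ([kr1_gf], [kr1_gf_walks]).  The
equations of the four factors under z -> z q^2 give a recurrence of order three,
[unstaired_gf_rec].

The left-hand side.  Removing the smallest parts and subtracting 2 or 4 from the
others maps between four classes of partitions: 2+2 is allowed or not, the part 1
is allowed or not.  The resulting linear system [count_no22S], [count_no1_no22S],
[count_anySS], [count_no1SS] determines the four families of series.  The fractions
[kr1_gf] and two sequences built from it solve the same system, by the recurrence
of order three, whence [represents_kr1].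

Positivity holds since P is a sum of powers of q and since each denominator is a
product of factors 1 - q^e, whose inverses have nonnegative coefficients. *)

(** * Sequences as series, and the walk generating functions *)

(** Multiplication by z^k on coefficients.  Truncated subtraction would not do:
[lag k f n] must vanish for n < k. *)
Fixpoint lag (R : nmodType) (k : nat) (f : nat -> R) (n : nat) : R :=
  match k, n with
  | 0, _ => f n
  | k'.+1, n'.+1 => lag k' f n'
  | _.+1, 0 => 0
  end.
Arguments lag : simpl never.

Lemma lag0 (R : nmodType) (f : nat -> R) n : lag 0 f n = f n.
Proof. by []. Qed.

Lemma lagS0 (R : nmodType) (f : nat -> R) k : lag k.+1 f 0 = 0.
Proof. by []. Qed.

Lemma lagSS (R : nmodType) (f : nat -> R) k n : lag k.+1 f n.+1 = lag k f n.
Proof. by []. Qed.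

Definition lagE := (lag0, lagS0, lagSS).

Definition qfact (R : pzRingType) (q : R) (n : nat) : R :=
  \prod_(i < n) (1 - q ^+ i.+1).

Lemma lag_sum (R : nmodType) (I : Type) (r : seq I) (f : I -> nat -> R) k n :
  lag k (fun m => \sum_(i <- r) f i m) n = \sum_(i <- r) lag k (f i) n.
Proof.
elim: k n => [|k IHk] [|n] //; first by rewrite lagS0 big1.
by rewrite lagSS IHk.
Qed.

Lemma lag_eq (R : nmodType) (f g : nat -> R) k n :
  (forall m, (m <= n)%N -> f m = g m) -> lag k f n = lag k g n.
Proof.
elim: k n => [|k IHk] [|n] fg; rewrite ?lagE ?fg //.
by apply: IHk => m lemn; apply: fg; apply: leqW.
Qed.

Lemma lag_lt (R : nmodType) (f : nat -> R) k n : (n < k)%N -> lag k f n = 0.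
Proof. by elim: k n => [|k IHk] [|n] // /IHk. Qed.

Lemma lag_sub (R : nmodType) (f : nat -> R) k n :
  (k <= n)%N -> lag k f n = f (n - k)%N.
Proof. by elim: k n => [|k IHk] [|n] // /IHk. Qed.

Lemma lagM (R : pzRingType) (c : R) (f : nat -> R) k n :
  lag k (fun m => c * f m) n = c * lag k f n.
Proof. by elim: k n => [|k IHk] [|n]; rewrite ?lagE ?mulr0. Qed.

(** Substituting q z for z commutes with multiplication by z^k up to q^k. *)
Lemma lagX (R : comPzRingType) (q : R) (f : nat -> R) k n :
  q ^+ k * lag k (fun m => q ^+ m * f m) n = q ^+ n * lag k f n.
Proof.
have [ltnk|lekn] := ltnP n k; first by rewrite !lag_lt ?mulr0.
by rewrite !lag_sub // mulrA -exprD subnKC.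
Qed.

(** A configuration with p pairs has at least 2p parts, so that for a given number
of parts the sum over p may be cut anywhere beyond. *)
Lemma sum_gf_widen (R : nmodType) (f : nat -> nat -> R) M B :
    (forall p n, (n < p.*2)%N -> f p n = 0) -> (M < B.*2)%N ->
  \sum_(p < B) f p M = \sum_(p < M.+1) f p M.
Proof.
have E C : (M < C.*2)%N -> (forall p n, (n < p.*2)%N -> f p n = 0) ->
    \sum_(p < C + M.+1) f p M = \sum_(p < C) f p M.
  move=> ltM f0; rewrite big_split_ord /= [X in _ + X]big1 ?addr0 // => i _.
  by rewrite f0 //; lia.
move=> f0 ltM; rewrite -E // addnC.
rewrite big_split_ord /= [X in _ + X]big1 ?addr0 // => i _.
by rewrite f0 //; lia.
Qed.

Lemma lag_sum_gf (R : nmodType) (f : nat -> nat -> R) k M B :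
    (forall p n, (n < p.*2)%N -> f p n = 0) -> (M < k + B.*2)%N ->
  \sum_(p < B) lag k (f p) M = lag k (fun m => \sum_(p < m.+1) f p m) M.
Proof.
move=> f0 ltM; rewrite -lag_sum; have [ltMk|leM] := ltnP M k.
  by rewrite !lag_lt.
by rewrite !lag_sub // sum_gf_widen //; lia.
Qed.

(** A state t is the sum of the two parts of a pair, and a step d leads to the next
pair, of sum t + d.  The step 5, from an odd state only, is the one that makes a
block: it also inserts the singleton (t+1)/2, hence the extra part and weight. *)
Definition steps (s : nat) : seq nat :=
  [:: 2; 3; 4]%N ++ (if odd s then [:: 5%N] else [::]).
Definition step_length (d : nat) : nat := (if d == 5 then 3 else 2)%N.
Definition step_weight (s d : nat) : nat :=
  ((if d == 5 then s.+1./2 else 0) + (s + d))%N.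

Section Recurrences.
Variables (F : fieldType) (q : F).

(** The M moveable singletons after a pair of sum s, the smaller part of which is
[s./2], where 1/(q;q)_M stands for the forward moves of these singletons. *)
Definition singletons_gf (s M : nat) : F := q ^+ (s./2 * M + M ^ 2) / qfact q M.

Fixpoint walk_gf (p s : nat) : nat -> F :=
  if p is p'.+1 then
    fun M => \sum_(d <- steps s)
      q ^+ step_weight s d * lag (step_length d) (walk_gf p' (s + d)) M
  else singletons_gf s.

(** Adding 1 to all parts moves a state by 2 and multiplies by q per part. *)
Lemma walk_gf_shift p s M : walk_gf p s.+2 M = q ^+ M * walk_gf p s M.
Proof.
elim: p s M => [|p IHp] s M /=.
  by rewrite /singletons_gf mulrA -exprD mulSn addnA.
rewrite /steps /= negbK mulr_sumr; apply: eq_bigr => d _.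
rewrite mulrCA -lagX [RHS]mulrA -exprD.
have -> : step_weight s.+2 d = (step_weight s d + step_length d)%N.
  by rewrite /step_weight /step_length; case: eqP => _; lia.
by congr (_ * _); apply: lag_eq => m _; rewrite addSn addSn IHp.
Qed.

Lemma walk_gf_small p s M : (M < p.*2)%N -> walk_gf p s M = 0.
Proof.
elim: p s M => [|p IHp] s M //=; rewrite doubleS => ltM.
rewrite big1 // => d _; rewrite -[RHS](mulr0 (q ^+ step_weight s d)).
congr (_ * _); have [ltMd|leMd] := ltnP M (step_length d); first by rewrite lag_lt.
rewrite lag_sub // IHp //; move: leMd; rewrite /step_length; case: ifP; lia.
Qed.

Lemma lag_walk_gf_shift k a p s M :
  q ^+ (k * a) * lag k (walk_gf p (s + a.*2)) M =
  (q ^+ M) ^+ a * lag k (walk_gf p s) M.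
Proof.
rewrite -exprM mulnC [(M * a)%N]mulnC !exprM -lagX; congr (_ * _).
apply: lag_eq => m _; rewrite -exprM mulnC exprM.
elim: a => [|a IHa]; first by rewrite addn0 mul1r.
by rewrite doubleS !addnS walk_gf_shift IHa mulrA -exprS.
Qed.

(** The series h_p and e_p: as all states of a parity are translates of one another,
the initial states 0 and 1 suffice. *)
Definition even_gf p M := (qfact (q ^+ 3) p)^-1 * walk_gf p 0 M.
Definition odd_gf p M := (qfact (q ^+ 3) p)^-1 * walk_gf p 1 M.

Definition twice_gf M := \sum_(p < M.+1) even_gf p M.

Lemma gf_small p M : (M < p.*2)%N -> even_gf p M = 0 /\ odd_gf p M = 0.
Proof. by move=> ltM; rewrite /even_gf /odd_gf !walk_gf_small ?mulr0. Qed.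

Lemma twice_gf0 : twice_gf 0 = 1.
Proof.
rewrite /twice_gf big_ord_recl big_ord0 addr0 /even_gf /= /singletons_gf /=.
by rewrite /qfact !big_ord0 !invr1 !mulr1.
Qed.

Hypothesis (q0 : q != 0) (q1 : forall n, 1 - q ^+ n.+1 != 0).

(** The induction step on the number p of pairs, for h0 = h_(p+1), h1 = h_p,
h2 = h_(p-1), likewise for e, and C = q^(3p).  The equations with 1 - C express the
splitting of the first step of a walk; the conclusion is the splitting according to
the smallest parts.  After multiplication by 1 - C q^3 everything is expressed by
h1 and e1, then, writing 1 - C q^3 = (1 - q^3) + q^3 (1 - C), by h2 and e2, and what
remains is a combination of the equations one step below. *)
Lemma pair_recurrence_step (C : F) (h2 e2 h1 e1 h0 e0 : nat -> F) :
    1 - C * q ^+ 3 != 0 ->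
    (forall M, (1 - C * q ^+ 3) * h0 M = q ^+ M * lag 2 h1 M
       + q ^+ M * q * lag 2 e1 M + q ^+ M * q ^+ M * lag 2 h1 M) ->
    (forall M, (1 - C * q ^+ 3) * e0 M = q ^+ M * q * lag 2 e1 M
       + (q ^+ M) ^+ 2 * lag 2 h1 M + (q ^+ M) ^+ 2 * q * lag 2 e1 M
       + (q ^+ M) ^+ 3 / q ^+ 2 * lag 3 h1 M) ->
    (forall M, (1 - C) * h1 M = q ^+ M * lag 2 h2 M
       + q ^+ M * q * lag 2 e2 M + q ^+ M * q ^+ M * lag 2 h2 M) ->
    (forall M, (1 - C) * e1 M = q ^+ M * q * lag 2 e2 M
       + (q ^+ M) ^+ 2 * lag 2 h2 M + (q ^+ M) ^+ 2 * q * lag 2 e2 M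
       + (q ^+ M) ^+ 3 / q ^+ 2 * lag 3 h2 M) ->
    (forall M, e1 M = h1 M - q ^+ M * lag 2 h2 M) ->
    (forall M, (1 - q ^+ M) * h1 M = (q ^+ M) ^+ 2 / q * lag 1 h1 M
       + q ^+ M * lag 2 h2 M + q ^+ M * q * lag 2 e2 M) ->
  (forall M, e0 M = h0 M - q ^+ M * lag 2 h1 M) /\
  (forall M, (1 - q ^+ M) * h0 M = (q ^+ M) ^+ 2 / q * lag 1 h0 M
       + q ^+ M * lag 2 h1 M + q ^+ M * q * lag 2 e1 M).
Proof.
move=> nzC Rh0 Re0 Rh1 Re1 S1 S2.
have Rh1' M : (1 - C) * lag 2 h1 M = q ^+ M / q ^+ 2 * lag 4 h2 M
    + q ^+ M / q * lag 4 e2 M + (q ^+ M / q ^+ 2) ^+ 2 * lag 4 h2 M.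
  by case: M => [|[|M]]; rewrite ?lagE ?Rh1 ?(exprS q M.+2) ?(exprS q M.+1) ?(exprS q M); field.
have Re1' M : (1 - C) * lag 2 e1 M = q ^+ M / q * lag 4 e2 M
    + (q ^+ M / q ^+ 2) ^+ 2 * (lag 4 h2 M + q * lag 4 e2 M)
    + (q ^+ M / q ^+ 2) ^+ 3 / q ^+ 2 * lag 5 h2 M.
  by case: M => [|[|M]]; rewrite ?lagE ?Re1 ?(exprS q M.+2) ?(exprS q M.+1) ?(exprS q M); field.
have S1' M : lag 2 e1 M = lag 2 h1 M - q ^+ M / q ^+ 2 * lag 4 h2 M.
  by case: M => [|[|M]]; rewrite ?lagE ?S1 ?(exprS q M.+2) ?(exprS q M.+1) ?(exprS q M); field.
have S1'' M : lag 3 e1 M = lag 3 h1 M - q ^+ M / q ^+ 3 * lag 5 h2 M.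
  by case: M => [|[|[|M]]]; rewrite ?lagE ?S1 ?(exprS q M.+2) ?(exprS q M.+1) ?(exprS q M); field.
have S2' M : (1 - q ^+ M / q ^+ 2) * lag 2 h1 M =
    (q ^+ M / q ^+ 2) ^+ 2 / q * lag 3 h1 M
    + q ^+ M / q ^+ 2 * lag 4 h2 M + q ^+ M / q * lag 4 e2 M.
  case: M => [|[|M]]; rewrite ?lagE; [by field | by field |].
  rewrite (exprS q M.+1) (exprS q M).
  rewrite [LHS](_ : _ = (1 - q ^+ M) * h1 M); last by field.
  by rewrite S2; field.
have Rh0' M : (1 - C * q ^+ 3) * lag 1 h0 M = q ^+ M / q * lag 3 h1 M
    + q ^+ M * lag 3 e1 M + (q ^+ M / q) ^+ 2 * lag 3 h1 M.
  by case: M => [|M]; rewrite ?lagE ?Rh0 ?(exprS q M.+2) ?(exprS q M.+1) ?(exprS q M); field.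
have sub0 (a b : F) : a = b -> a - b = 0 by move->; rewrite subrr.
(* Each goal is written out as a combination of the known equations; their
   coefficients come from eliminating first e1, then e2. *)
split=> M; apply: (mulfI nzC); apply/eqP; rewrite -subr_eq0; apply/eqP.
  rewrite [LHS](_ : _ =
      ((1 - C * q ^+ 3) * e0 M - (q ^+ M * q * lag 2 e1 M
       + (q ^+ M) ^+ 2 * lag 2 h1 M + (q ^+ M) ^+ 2 * q * lag 2 e1 M
       + (q ^+ M) ^+ 3 / q ^+ 2 * lag 3 h1 M))
    - ((1 - C * q ^+ 3) * h0 M - (q ^+ M * lag 2 h1 M
       + q ^+ M * q * lag 2 e1 M + q ^+ M * q ^+ M * lag 2 h1 M))
    + q ^+ 3 * q ^+ M * ((1 - C) * lag 2 h1 M - (q ^+ M / q ^+ 2 * lag 4 h2 M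
    + q ^+ M / q * lag 4 e2 M + (q ^+ M / q ^+ 2) ^+ 2 * lag 4 h2 M))
    - q ^+ 3 * q ^+ M * ((1 - q ^+ M / q ^+ 2) * lag 2 h1 M
      - ((q ^+ M / q ^+ 2) ^+ 2 / q * lag 3 h1 M
    + q ^+ M / q ^+ 2 * lag 4 h2 M + q ^+ M / q * lag 4 e2 M))
    + (q ^+ M) ^+ 2 * q * (lag 2 e1 M
       - (lag 2 h1 M - q ^+ M / q ^+ 2 * lag 4 h2 M))); last by field.
  rewrite (sub0 _ _ (Re0 M)) (sub0 _ _ (Rh0 M)) (sub0 _ _ (Rh1' M)).
  by rewrite (sub0 _ _ (S2' M)) (sub0 _ _ (S1' M)) !mulr0 !subr0 !addr0.
rewrite [LHS](_ : _ =
    (1 - q ^+ M) * ((1 - C * q ^+ 3) * h0 M - (q ^+ M * lag 2 h1 M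
       + q ^+ M * q * lag 2 e1 M + q ^+ M * q ^+ M * lag 2 h1 M))
  - (q ^+ M) ^+ 2 / q * ((1 - C * q ^+ 3) * lag 1 h0 M -
      (q ^+ M / q * lag 3 h1 M
    + q ^+ M * lag 3 e1 M + (q ^+ M / q) ^+ 2 * lag 3 h1 M))
  - q ^+ M * q ^+ 3 * ((1 - C) * lag 2 h1 M - (q ^+ M / q ^+ 2 * lag 4 h2 M
    + q ^+ M / q * lag 4 e2 M + (q ^+ M / q ^+ 2) ^+ 2 * lag 4 h2 M))
  - q ^+ M * q ^+ 4 * ((1 - C) * lag 2 e1 M - (q ^+ M / q * lag 4 e2 M
    + (q ^+ M / q ^+ 2) ^+ 2 * (lag 4 h2 M + q * lag 4 e2 M)
    + (q ^+ M / q ^+ 2) ^+ 3 / q ^+ 2 * lag 5 h2 M))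
  + (q ^+ M * q ^+ 3 + q ^+ M * q ^+ 4 + (q ^+ M) ^+ 2 * q ^+ 2) *
     ((1 - q ^+ M / q ^+ 2) * lag 2 h1 M
      - ((q ^+ M / q ^+ 2) ^+ 2 / q * lag 3 h1 M
    + q ^+ M / q ^+ 2 * lag 4 h2 M + q ^+ M / q * lag 4 e2 M))
  + (q ^+ M * q ^+ 4 - (q ^+ M) ^+ 2 * q) * (lag 2 e1 M
       - (lag 2 h1 M - q ^+ M / q ^+ 2 * lag 4 h2 M))
  - (q ^+ M) ^+ 3 / q * (lag 3 e1 M
       - (lag 3 h1 M - q ^+ M / q ^+ 3 * lag 5 h2 M))); last by field.
rewrite (sub0 _ _ (Rh0 M)) (sub0 _ _ (Rh0' M)) (sub0 _ _ (Rh1' M)).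
rewrite (sub0 _ _ (Re1' M)) (sub0 _ _ (S2' M)) (sub0 _ _ (S1' M)).
by rewrite (sub0 _ _ (S1'' M)) !mulr0 !subr0 !addr0.
Qed.

Lemma qfact_neq0 k n : qfact (q ^+ k.+1) n != 0.
Proof.
by apply/prodf_neq0 => i _; rewrite -exprM mulSn; exact: q1.
Qed.

Lemma mul_qfactS p (x : F) :
  (1 - (q ^+ 3) ^+ p * q ^+ 3) * ((qfact (q ^+ 3) p.+1)^-1 * x) =
  (qfact (q ^+ 3) p)^-1 * x.
Proof.
rewrite /qfact big_ord_recr /= -/(qfact _ _) -exprSr.
have nz := qfact_neq0 2 p; have nz' : 1 - (q ^+ 3) ^+ p.+1 != 0.
  by rewrite -exprM mulnS; exact: q1.
by field; rewrite nz nz'.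
Qed.

(** The first step from 0 leads to the pairs [1,1], [1,2] or [2,2]. *)
Lemma even_gfS p M : (1 - (q ^+ 3) ^+ p * q ^+ 3) * even_gf p.+1 M =
  q ^+ M * lag 2 (even_gf p) M + q ^+ M * q * lag 2 (odd_gf p) M
  + q ^+ M * q ^+ M * lag 2 (even_gf p) M.
Proof.
rewrite mul_qfactS !lagM /= /steps /= !big_cons big_nil.
rewrite /step_weight /step_length /=.
have E2 : q ^+ 2 * lag 2 (walk_gf p 2) M = q ^+ M * lag 2 (walk_gf p 0) M.
  exact: (lag_walk_gf_shift 2 1 p 0 M).
have E3 : q ^+ 2 * lag 2 (walk_gf p 3) M = q ^+ M * lag 2 (walk_gf p 1) M.
  exact: (lag_walk_gf_shift 2 1 p 1 M).
have E4 : q ^+ 4 * lag 2 (walk_gf p 4) M = (q ^+ M) ^+ 2 * lag 2 (walk_gf p 0) M.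
  exact: (lag_walk_gf_shift 2 2 p 0 M).
rewrite !add0n E2 E4 (exprS q 2) -[_ * _ * lag 2 (walk_gf p 3) M]mulrA E3; ring.
Qed.

(** The first step from 1 leads to [1,2], [2,2], [2,3], or to the block completion
1, [3,3], of weight 7. *)
Lemma odd_gfS p M : (1 - (q ^+ 3) ^+ p * q ^+ 3) * odd_gf p.+1 M =
  q ^+ M * q * lag 2 (odd_gf p) M
  + (q ^+ M) ^+ 2 * lag 2 (even_gf p) M
  + (q ^+ M) ^+ 2 * q * lag 2 (odd_gf p) M
  + (q ^+ M) ^+ 3 / q ^+ 2 * lag 3 (even_gf p) M.
Proof.
rewrite mul_qfactS !lagM /= /steps /= !big_cons big_nil.
rewrite /step_weight /step_length /=.
have E3 : q ^+ 2 * lag 2 (walk_gf p 3) M = q ^+ M * lag 2 (walk_gf p 1) M.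
  exact: (lag_walk_gf_shift 2 1 p 1 M).
have E4 : q ^+ 4 * lag 2 (walk_gf p 4) M = (q ^+ M) ^+ 2 * lag 2 (walk_gf p 0) M.
  exact: (lag_walk_gf_shift 2 2 p 0 M).
have E5 : q ^+ 4 * lag 2 (walk_gf p 5) M = (q ^+ M) ^+ 2 * lag 2 (walk_gf p 1) M.
  exact: (lag_walk_gf_shift 2 2 p 1 M).
have E6 : q ^+ 9 * lag 3 (walk_gf p 6) M = (q ^+ M) ^+ 3 * lag 3 (walk_gf p 0) M.
  exact: (lag_walk_gf_shift 3 3 p 0 M).
have E6' : q ^+ 7 * lag 3 (walk_gf p 6) M =
    (q ^+ M) ^+ 3 / q ^+ 2 * lag 3 (walk_gf p 0) M.
  by rewrite [RHS]mulrAC -E6; field.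
rewrite !add0n (exprS q 2) -[_ * _ * lag 2 (walk_gf p 3) M]mulrA E3 E4.
rewrite (exprS q 4) -[_ * _ * lag 2 (walk_gf p 5) M]mulrA E5 E6'; ring.
Qed.

(** For p = 0 there are only singletons, and the second equation is that of the
Rogers-Ramanujan series sum_M q^(M^2) z^M / (q;q)_M. *)
Lemma even_odd_gf p :
  let prev f := if p is p'.+1 then f p' else fun=> 0 in
  (forall M, odd_gf p M = even_gf p M - q ^+ M * lag 2 (prev even_gf) M) /\
  (forall M, (1 - q ^+ M) * even_gf p M =
     (q ^+ M) ^+ 2 / q * lag 1 (even_gf p) M
     + q ^+ M * lag 2 (prev even_gf) M + q ^+ M * q * lag 2 (prev odd_gf) M).
Proof.
have lag0f k n : lag k (fun=> 0 : F) n = 0 by elim: k n => [|k IH] [|n]; rewrite ?lagE.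
have nzC i : 1 - (q ^+ 3) ^+ i * q ^+ 3 != 0 by rewrite -exprSr -exprM mulnS; exact: q1.
have qf n : qfact q n != 0 by have := qfact_neq0 0 n; rewrite expr1.
elim: p => [|p [IH1 IH2]] /=; last first.
  case: p IH1 IH2 => [|p] /= IH1 IH2.
    apply: (@pair_recurrence_step 1 (fun=> 0) (fun=> 0) _ _ _ _ (nzC 0)) => // M.
    - exact: (even_gfS 0).
    - exact: (odd_gfS 0).
    - by rewrite subrr mul0r !lag0f; ring.
    - by rewrite subrr mul0r !lag0f; ring.
  apply: pair_recurrence_step (nzC p.+1) _ _ _ _ IH1 IH2 => M.
  - exact: even_gfS.
  - exact: odd_gfS.
  - by rewrite exprSr even_gfS.
  - by rewrite exprSr odd_gfS.
split=> M; rewrite !lag0f !mulr0 ?addr0 ?subr0 //.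
case: M => [|M]; first by rewrite lagS0 subrr mul0r mulr0.
rewrite lagSS lag0 /even_gf /= /singletons_gf /= /qfact big_ord0 big_ord_recr /=.
rewrite -/(qfact q M) invr1 !mul1r !mul0n !add0n.
have -> : (M.+1 ^ 2 = M ^ 2 + M + M.+1)%N by lia.
have nzM := q1 M; have nzf := qf M.
rewrite !exprD (exprS q M) in nzM *.
by field; rewrite nzM nzf q0.
Qed.

(** Summed over p, [even_odd_gf] says that E(z) = H(z) - z^2 q^2 H(zq) and
H(z) = H(zq) + z q H(zq^2) + z^2 q^2 H(zq) + z^2 q^3 E(zq).  If D is the difference
of the two sides of the claim, it follows that D(z) = - z q D(zq) + z^2 q^3 D(zq),
so that D = 0 coefficient by coefficient. *)
Lemma twice_gf_rec M :
  (1 - q ^+ M) * twice_gf M =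
  q ^+ M * lag 1 twice_gf M + q ^+ M * lag 2 twice_gf M.
Proof.
have ev0 p n : (n < p.*2)%N -> even_gf p n = 0 by case/gf_small.
have od0 p n : (n < p.*2)%N -> odd_gf p n = 0 by case/gf_small.
pose G n := \sum_(p < n.+1) odd_gf p n.
have E2 n : \sum_(p < n.+1) lag 2 (if p : nat is p'.+1 then even_gf p' else fun=> 0) n
   = lag 2 twice_gf n.
  rewrite big_ord_recl /= (_ : lag 2 (fun=> 0 : F) n = 0) ?add0r.
    by apply: lag_sum_gf => //; lia.
  by case: n => [|[|n]]; rewrite ?lagE.
have O2 n : \sum_(p < n.+1) lag 2 (if p : nat is p'.+1 then odd_gf p' else fun=> 0) n
   = lag 2 G n.
  rewrite big_ord_recl /= (_ : lag 2 (fun=> 0 : F) n = 0) ?add0r.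
    by apply: lag_sum_gf => //; lia.
  by case: n => [|[|n]]; rewrite ?lagE.
have S1 n : G n = twice_gf n - q ^+ n * lag 2 twice_gf n.
  rewrite -E2 mulr_sumr -sumrB; apply: eq_bigr => p _.
  by have [/(_ n)-> _] := even_odd_gf p; case: (nat_of_ord p).
have S2 n : (1 - q ^+ n) * twice_gf n = (q ^+ n) ^+ 2 / q * lag 1 twice_gf n
    + q ^+ n * lag 2 twice_gf n + q ^+ n * q * lag 2 G n.
  rewrite -E2 -O2 -(lag_sum_gf (B := n.+1)) //; last lia.
  rewrite !mulr_sumr -!big_split; apply: eq_bigr => p _ /=.
  by have [_ /(_ n)->] := even_odd_gf p; case: (nat_of_ord p).
pose D n := (1 - q ^+ n) * twice_gf n
  - (q ^+ n * lag 1 twice_gf n + q ^+ n * lag 2 twice_gf n).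
suff D0 : forall n, D n = 0 by apply/eqP; rewrite -subr_eq0; apply/eqP/D0.
have DE n : D n = - q ^+ n * lag 1 D n + q ^+ n * q * lag 2 D n.
  rewrite {1}/D S2.
  case: n => [|[|n]]; rewrite /D ?lagE ?S1.
  - by ring.
  - by rewrite expr0 subrr mul0r expr1; field.
  rewrite ?lagE (exprS q n.+1) (exprS q n).
  by field.
elim/ltn_ind=> n IHn; rewrite DE.
case: n IHn => [|[|n]] IHn; rewrite ?lagE ?IHn // ?mulr0 ?addr0 //.
Qed.

End Recurrences.

(** * The generating function of the right-hand side *)

Definition convolution (R : pzRingType) (f g : nat -> R) (n : nat) : R :=
  \sum_(i < n.+1) f i * g (n - i)%N.

Lemma convolutionDl (R : pzRingType) (f f' g : nat -> R) n :
  convolution (fun m => f m + f' m) g n = convolution f g n + convolution f' g n.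
Proof. by rewrite -big_split; apply: eq_bigr => i _; rewrite mulrDl. Qed.

Lemma convolutionZl (R : pzRingType) (c : R) (f g : nat -> R) n :
  convolution (fun m => c * f m) g n = c * convolution f g n.
Proof. by rewrite mulr_sumr; apply: eq_bigr => i _; rewrite mulrA. Qed.

Lemma eq_convolution (R : pzRingType) (f f' g g' : nat -> R) n :
  f =1 f' -> g =1 g' -> convolution f g n = convolution f' g' n.
Proof. by move=> ff gg; apply: eq_bigr => i _; rewrite ff gg. Qed.

Lemma convolutionC (R : comPzRingType) (f g : nat -> R) n :
  convolution f g n = convolution g f n.
Proof.
rewrite /convolution (reindex_inj rev_ord_inj); apply: eq_bigr => i _ /=.
by rewrite subSS mulrC subKn // -ltnS.
Qed.

Lemma convolution_lagl (R : pzRingType) k (f g : nat -> R) n :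
  convolution (lag k f) g n = lag k (convolution f g) n.
Proof.
elim: k f n => [|k IHk] f n //; case: n => [|n].
  by rewrite /convolution big_ord_recl big_ord0 !lagS0 mul0r addr0.
by rewrite lagSS -IHk /convolution big_ord_recl lagS0 mul0r add0r.
Qed.

Lemma convolution_lagr (R : comPzRingType) k (f g : nat -> R) n :
  convolution f (lag k g) n = lag k (convolution f g) n.
Proof.
by rewrite convolutionC convolution_lagl; apply: lag_eq => m _; apply: convolutionC.
Qed.

Lemma convolution_scale (R : comPzRingType) (a : R) (f g : nat -> R) n :
  convolution (fun m => a ^+ m * f m) (fun m => a ^+ m * g m) n
  = a ^+ n * convolution f g n.
Proof.
rewrite mulr_sumr; apply: eq_bigr => i _.
by rewrite mulrACA -exprD subnKC // -ltnS.
Qed.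

Lemma convolutionDr (R : comPzRingType) (f g g' : nat -> R) n :
  convolution f (fun m => g m + g' m) n = convolution f g n + convolution f g' n.
Proof. by rewrite convolutionC convolutionDl !(convolutionC f). Qed.

Lemma convolutionZr (R : comPzRingType) (c : R) (f g : nat -> R) n :
  convolution f (fun m => c * g m) n = c * convolution f g n.
Proof. by rewrite convolutionC convolutionZl convolutionC. Qed.

Lemma lagD (R : nmodType) (f g : nat -> R) k n :
  lag k (fun m => f m + g m) n = lag k f n + lag k g n.
Proof. by elim: k n => [|k IHk] [|n]; rewrite ?lagE ?addr0. Qed.

Lemma lag_lag (R : nmodType) (f : nat -> R) j k n :
  lag j (lag k f) n = lag (j + k) f n.
Proof. by elim: j n => [|j IHj] [|n] //; rewrite lagSS IHj. Qed.

Section PartsSeries.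
Variables (F : fieldType) (q : F).
Hypothesis (q0 : q != 0) (q1 : forall n, 1 - q ^+ n.+1 != 0).

(** Coefficients of 1/(zq;q^2)_oo and, for [double_gf], of 1/(z^2 q^4;q^4)_oo. *)
Definition odd_parts_gf (i : nat) : F := q ^+ i / qfact (q ^+ 2) i.
Definition double_gf (m : nat) : F :=
  if odd m then 0 else q ^+ (4 * m./2) / qfact (q ^+ 4) m./2.

Lemma qfactS_neq0 k n : 1 - (q ^+ k.+1) ^+ n.+1 != 0.
Proof. by rewrite -exprM mulSn; exact: q1. Qed.

Lemma odd_parts_gf_rec i : (q ^+ 2) ^+ i * odd_parts_gf i = odd_parts_gf i + - q * lag 1 odd_parts_gf i.
Proof.
case: i => [|i]; first by rewrite lagE mul1r mulr0 addr0.
rewrite lagSS lag0 /odd_parts_gf /qfact big_ord_recr /= -/(qfact _ _).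
have nz := qfact_neq0 q1 1 i; have nz' := qfactS_neq0 1 i.
move: nz'; rewrite (exprS q i) => nz'.
by field; rewrite nz nz'.
Qed.

Lemma double_gf_rec m :
  (q ^+ 2) ^+ m * double_gf m = double_gf m + - q ^+ 4 * lag 2 double_gf m.
Proof.
case: m => [|[|m]]; rewrite ?lagE /double_gf /=; [by ring | by ring |].
rewrite negbK; case: ifP => om; first by ring.
have -> : m = m./2.*2 by lia.
move: m./2 => j; rewrite doubleK.
rewrite /qfact big_ord_recr /= -/(qfact _ _).
have nz := qfact_neq0 q1 3 j; have nz' := qfactS_neq0 3 j.
have -> : (4 * j.+1 = 4 + 4 * j)%N by lia.
have -> : (q ^+ 2) ^+ j.*2.+2 = q ^+ (4 + 4 * j).
  by rewrite -exprM; congr (_ ^+ _); lia.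
move: nz'; rewrite exprS -exprM exprD => nz'.
by field; rewrite nz nz'.
Qed.

(** The product of all the factors except 1/(1 - z); the latter is the summation over
k, which has no weight before the factor q^(N^2), so that k counts parts equal to 0. *)
Definition nonzero_gf : nat -> F :=
  convolution (convolution (twice_gf (q ^+ 2)) odd_parts_gf) double_gf.

Lemma q21 n : 1 - (q ^+ 2) ^+ n.+1 != 0.
Proof. exact: qfactS_neq0 1 n. Qed.

(** The factors satisfy H(z) = (1 + zq^2 + z^2q^4) H(zq^2), A(zq^2) = (1 - zq) A(z) and
B(zq^2) = (1 - z^2q^4) B(z); multiply. *)
Lemma nonzero_gf_rec n :
  nonzero_gf n + - q * lag 1 nonzero_gf n + - q ^+ 4 * lag 2 nonzero_gf n
    + q ^+ 5 * lag 3 nonzero_gf n =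
  q ^+ (2 * n) * (nonzero_gf n + lag 1 nonzero_gf n + lag 2 nonzero_gf n).
Proof.
pose scaled f m : F := (q ^+ 2) ^+ m * f m.
have hE m : twice_gf (q ^+ 2) m = scaled (twice_gf (q ^+ 2)) m
    + ((q ^+ 2) * lag 1 (scaled (twice_gf (q ^+ 2))) m
    + (q ^+ 2) ^+ 2 * lag 2 (scaled (twice_gf (q ^+ 2))) m).
  have := lagX (q ^+ 2) (twice_gf (q ^+ 2)) 1 m; rewrite expr1 => ->.
  rewrite lagX; have := twice_gf_rec (expf_neq0 2 q0) q21 m.
  by move=> <-; rewrite /scaled; ring.
pose s f m : F := f m + ((q ^+ 2) * lag 1 f m + (q ^+ 2) ^+ 2 * lag 2 f m).
have sM f g m : convolution (s f) g m = s (convolution f g) m.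
  by rewrite /s !convolutionDl !convolutionZl !convolution_lagl.
have eq_s f g m : f =1 g -> s f m = s g m.
  move=> fg; rewrite /s fg; congr (_ + (_ * _ + _ * _));
    by apply: lag_eq => k _; apply: fg.
pose h := twice_gf (q ^+ 2).
have E m : s (scaled nonzero_gf) m = convolution (convolution h
    (fun m => odd_parts_gf m + - q * lag 1 odd_parts_gf m))
    (fun m => double_gf m + - q ^+ 4 * lag 2 double_gf m) m.
  transitivity (s (convolution (convolution (scaled h) (scaled odd_parts_gf)) (scaled double_gf)) m).
    apply: eq_s => k; rewrite /scaled -convolution_scale.
    by apply: eq_convolution => // j; rewrite convolution_scale.
  rewrite -sM; apply: eq_convolution => k; last exact: double_gf_rec.
  rewrite -sM; apply: eq_convolution => j; last exact: odd_parts_gf_rec.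
  by rewrite /h hE.
have := E n.
have -> : s (scaled nonzero_gf) n =
   q ^+ (2 * n) * (nonzero_gf n + lag 1 nonzero_gf n + lag 2 nonzero_gf n).
  have := lagX (q ^+ 2) nonzero_gf 1 n; rewrite expr1 /s => ->.
  by rewrite lagX /scaled exprM; ring.
move->.
rewrite convolutionDr convolutionZr convolution_lagr.
have E1 m : convolution (convolution h (fun m => odd_parts_gf m + - q * lag 1 odd_parts_gf m))
   double_gf m = nonzero_gf m + - q * lag 1 nonzero_gf m.
  rewrite /nonzero_gf -convolution_lagl -convolutionZl -convolutionDl.
  apply: eq_convolution => // k.
  by rewrite convolutionDr convolutionZr convolution_lagr.
rewrite E1.
have -> : lag 2 (convolution (convolution h
    (fun m => odd_parts_gf m + - q * lag 1 odd_parts_gf m)) double_gf) n =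
    lag 2 (fun m => nonzero_gf m + - q * lag 1 nonzero_gf m) n.
  by apply: lag_eq => k _; apply: E1.
rewrite lagD lagM lag_lag; ring.
Qed.

(** The coefficients of z^N before the staircase 1 + 3 + ... + (2N-1) = N^2 is put back. *)
Definition unstaired_gf (n : nat) : F := \sum_(k < n.+1) nonzero_gf k.

Lemma nonzero_unstaired n : nonzero_gf n = unstaired_gf n - lag 1 unstaired_gf n.
Proof.
case: n => [|n]; first by rewrite lagE subr0 /unstaired_gf big_ord1.
by rewrite lagSS lag0 {1}/unstaired_gf big_ord_recr /= [X in X - _]addrC addrK.
Qed.

(** Substituting [nonzero_unstaired] into [nonzero_gf_rec] gives an equation of order
four, which is E(z) = q^2 z E(z) for the expression E of order three. *)
Lemma unstaired_gf_rec n :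
  (1 - q ^+ (2 * n)) * unstaired_gf n - (1 + q - q ^+ 2 + q ^+ (2 * n)) * lag 1 unstaired_gf n
  - (q ^+ (2 * n) - q + q ^+ 2 + q ^+ 3) * lag 2 unstaired_gf n
  + q ^+ 3 * lag 3 unstaired_gf n = 0.
Proof.
pose E n := (1 - q ^+ (2 * n)) * unstaired_gf n
  - (1 + q - q ^+ 2 + q ^+ (2 * n)) * lag 1 unstaired_gf n
  - (q ^+ (2 * n) - q + q ^+ 2 + q ^+ 3) * lag 2 unstaired_gf n
  + q ^+ 3 * lag 3 unstaired_gf n.
suff EE m : E m = q ^+ 2 * lag 1 E m.
  rewrite -/(E n); elim: n => [|n IHn]; rewrite EE ?lagE ?mulr0 //.
  by rewrite IHn mulr0.
apply/eqP; rewrite -subr_eq0; apply/eqP.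
have := nonzero_gf_rec m => /eqP; rewrite -subr_eq0 => /eqP <-.
have lagsp k : lag k nonzero_gf m = lag k unstaired_gf m - lag k.+1 unstaired_gf m.
  have [ltmk|lekm] := ltnP m k; first by rewrite !lag_lt ?subr0 // ltnW.
  rewrite !(@lag_sub _ _ k) // nonzero_unstaired; congr (_ - _); move: lekm.
  elim: k m => [|k IHk] [|m] //; first by rewrite ltnS => /IHk; rewrite subSS lagSS.
rewrite !lagsp nonzero_unstaired /E.
have -> : lag 1 (fun n => (1 - q ^+ (2 * n)) * unstaired_gf n
  - (1 + q - q ^+ 2 + q ^+ (2 * n)) * lag 1 unstaired_gf n
  - (q ^+ (2 * n) - q + q ^+ 2 + q ^+ 3) * lag 2 unstaired_gf n
  + q ^+ 3 * lag 3 unstaired_gf n) m =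
  (1 - q ^+ (2 * m) / q ^+ 2) * lag 1 unstaired_gf m
  - (1 + q - q ^+ 2 + q ^+ (2 * m) / q ^+ 2) * lag 2 unstaired_gf m
  - (q ^+ (2 * m) / q ^+ 2 - q + q ^+ 2 + q ^+ 3) * lag 3 unstaired_gf m
  + q ^+ 3 * lag 4 unstaired_gf m.
  case: m {lagsp} => [|m]; rewrite !lagE; first by ring.
  have -> : (2 * m.+1 = 2 + 2 * m)%N by lia.
  by rewrite exprD; field.
by field.
Qed.

Definition kr1_gf (n : nat) : F := q ^+ (n ^ 2) * unstaired_gf n.

(** The series of [spaced_no1], solved from the equation of [no1_no22_gfS]; that it also
obeys [no1_gf_rec] is where the recurrence of order three enters. *)
Definition no1_gf (n : nat) : F :=
  (kr1_gf n.+2 * (1 - q ^+ (2 * n) * q ^+ 4)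
   - q ^+ (2 * n) * (q ^+ 3 + q ^+ 4) * kr1_gf n.+1
   + (q ^+ (2 * n)) ^+ 2 * q ^+ 5 * kr1_gf n) / ((q ^+ (2 * n)) ^+ 3 * q ^+ 8).

Lemma lag1_kr1_gf n :
  lag 1 kr1_gf n = q ^+ (n ^ 2) * q / q ^+ (2 * n) * lag 1 unstaired_gf n.
Proof.
case: n => [|n]; rewrite !lagE ?mulr0 // /kr1_gf.
have -> : (n.+1 ^ 2 = n ^ 2 + 2 * n + 1)%N by lia.
have -> : (2 * n.+1 = 2 * n + 2)%N by lia.
by rewrite !exprD; field; rewrite expf_neq0 ?q0.
Qed.

Lemma lag2_kr1_gf n :
  lag 2 kr1_gf n = q ^+ (n ^ 2) * q ^+ 4 / (q ^+ (2 * n)) ^+ 2 * lag 2 unstaired_gf n.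
Proof.
case: n => [|[|n]]; rewrite !lagE ?mulr0 // /kr1_gf.
have -> : (n.+2 ^ 2 = n ^ 2 + 2 * n + 2 * n + 4)%N by lia.
have -> : (2 * n.+2 = 2 * n + 4)%N by lia.
by rewrite !exprD; field; rewrite expf_neq0 ?q0.
Qed.

(** The definition of [no1_gf] two steps back; for n = 1 the claim is no longer the
definition but the first instance of the recurrence. *)
Lemma lag2_no1_gf n :
  lag 2 no1_gf n * (q ^+ (2 * n)) ^+ 3 / q ^+ 4 =
  (1 - q ^+ (2 * n)) * kr1_gf n
  - (q ^+ (2 * n) / q + q ^+ (2 * n)) * lag 1 kr1_gf n
  + (q ^+ (2 * n)) ^+ 2 / q ^+ 3 * lag 2 kr1_gf n.
Proof.
case: n => [|[|n]]; rewrite !lagE.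
- by ring.
- have := unstaired_gf_rec 1; rewrite !lagE /kr1_gf !muln1 exp1n !mulr0 => /eqP.
  rewrite !subr0 addr0 subr_eq0 expr1 expr0 => /eqP E.
  by rewrite [(1 - _) * _]mulrCA E; field.
have -> : (2 * n.+2 = 2 * n + 4)%N by lia.
rewrite /no1_gf exprD; field.
by rewrite q0 expf_neq0.
Qed.

(** Up to a factor, the difference of the two sides is q^4 E(n+2) - q^6 E(n+1), where E is
the expression that vanishes by [unstaired_gf_rec]. *)
Lemma no1_gf_rec n :
  no1_gf n = kr1_gf n - q ^+ (2 * n) / q * lag 1 kr1_gf n
             + (q ^+ (2 * n)) ^+ 2 / q ^+ 4 * lag 2 no1_gf n.
Proof.
have nzu : q ^+ (2 * n) != 0 by rewrite expf_neq0.
have -> : lag 2 no1_gf n = q ^+ 4 / (q ^+ (2 * n)) ^+ 3 *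
    (lag 2 no1_gf n * (q ^+ (2 * n)) ^+ 3 / q ^+ 4).
  by field; rewrite q0 nzu.
rewrite lag2_no1_gf lag1_kr1_gf lag2_kr1_gf /no1_gf /kr1_gf.
have := unstaired_gf_rec n.+2; have := unstaired_gf_rec n.+1; rewrite !lagE.
have -> : (n.+2 ^ 2 = n ^ 2 + 2 * n + 2 * n + 4)%N by lia.
have -> : (n.+1 ^ 2 = n ^ 2 + 2 * n + 1)%N by lia.
have -> : (2 * n.+2 = 2 * n + 4)%N by lia.
have -> : (2 * n.+1 = 2 * n + 2)%N by lia.
(* the exponent 2 n has to stay folded under exprD *)
move: (2 * n)%N nzu => e nzu; rewrite !(exprD q) => E1 E2.
apply/eqP; rewrite -subr_eq0; apply/eqP.
(* the coefficients of E(n+2) and E(n+1) after division by the leading factor *)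
rewrite -[RHS](mulr0 (q ^+ (n ^ 2) / (q ^+ e * q ^+ 4))) -{}E2.
rewrite -[RHS]subr0 -[X in _ = _ - X](mulr0 (q ^+ (n ^ 2) / (q ^+ e * q ^+ 2))) -{}E1.
by field; rewrite q0 nzu.
Qed.

(** The series of [spaced_no1_no22], solved from the equation of [kr1_gfS]. *)
Definition no1_no22_gf (n : nat) : F := kr1_gf n - q ^+ (2 * n) / q * lag 1 kr1_gf n.

Lemma kr1_gf0 : kr1_gf 0 = 1.
Proof.
rewrite /kr1_gf /unstaired_gf big_ord1 /nonzero_gf mul1r.
rewrite /convolution !big_ord1 twice_gf0 /odd_parts_gf /double_gf /=.
by rewrite /qfact !big_ord0 !divr1 !mul1r.
Qed.

Lemma no1_no22_gf0 : no1_no22_gf 0 = 1.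
Proof. by rewrite /no1_no22_gf kr1_gf0 lagS0 mulr0 subr0. Qed.

Lemma no1_gf0 : no1_gf 0 = 1.
Proof. by rewrite no1_gf_rec !lagE !mulr0 subr0 addr0 kr1_gf0. Qed.

Lemma no1_gf1 : no1_gf 1 = no1_no22_gf 1.
Proof. by rewrite no1_gf_rec (_ : lag 2 no1_gf 1 = 0) // mulr0 addr0. Qed.

Lemma no1_gfSS n : no1_gf n.+2 = no1_no22_gf n.+2 + q ^+ (4 * n + 4) * no1_gf n.
Proof.
rewrite no1_gf_rec -/(no1_no22_gf n.+2) lagSS lagSS lag0; congr (_ + _ * _).
have -> : (2 * n.+2 = 2 * n + 4)%N by lia.
have -> : (4 * n + 4 = (2 * n) * 2 + 4)%N by lia.
move: (2 * n)%N => e; rewrite -exprM -exprB ?unitfE //; last lia.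
by congr (_ ^+ _); lia.
Qed.

Lemma kr1_gfS n : kr1_gf n.+1 = no1_no22_gf n.+1 + q ^+ (2 * n + 1) * kr1_gf n.
Proof.
rewrite /no1_no22_gf lagSS lag0 -[LHS](subrK (q ^+ (2 * n + 1) * kr1_gf n)).
congr (_ - _ * _ + _); have -> : (2 * n.+1 = (2 * n + 1).+1)%N by lia.
by rewrite exprS mulrAC mulfV // mul1r.
Qed.

Lemma no1_no22_gfS n : no1_no22_gf n.+1 = q ^+ (2 * n + 2) *
  (kr1_gf n.+1 + (if n is n'.+1 then q ^+ (4 * n) * no1_gf n' else 0) + no1_no22_gf n).
Proof.
have nzu : q ^+ (2 * n) != 0 by rewrite expf_neq0.
have -> : (if n is n'.+1 then q ^+ (4 * n) * no1_gf n' else 0) =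
    q ^+ (4 * n) * lag 2 no1_gf n.+1 by case: n {nzu} => [|n]; rewrite ?lagE ?mulr0.
have -> : lag 2 no1_gf n.+1 = q ^+ 4 / (q ^+ (2 * n + 2)) ^+ 3 *
    (lag 2 no1_gf n.+1 * (q ^+ (2 * n.+1)) ^+ 3 / q ^+ 4).
  have -> : (2 * n.+1 = 2 * n + 2)%N by lia.
  by move: (2 * n)%N nzu => e nzu; rewrite exprD; field; rewrite q0 nzu.
rewrite lag2_no1_gf /no1_no22_gf !lagSS lag0.
have -> : (4 * n = (2 * n) * 2)%N by lia.
have -> : (2 * n.+1 = 2 * n + 2)%N by lia.
move: (2 * n)%N nzu => e nzu; rewrite exprM exprD.
by field; rewrite q0 nzu.
Qed.

Lemma kr1_gf_solved n : kr1_gf n.+1 =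
  (q ^+ (2 * n + 2) * ((if n is n'.+1 then q ^+ (4 * n) * no1_gf n' else 0) + no1_no22_gf n)
   + q ^+ (2 * n + 1) * kr1_gf n) / (1 - q ^+ (2 * n + 2)).
Proof.
have nz : 1 - q ^+ (2 * n + 2) != 0 by rewrite addn2; exact: q1.
apply: (canRL (mulfK nz)); rewrite mulrBr mulr1 {1}kr1_gfS no1_no22_gfS.
move: (if n is _.+1 then _ else _) => w; ring.
Qed.
End PartsSeries.

(** * Base partitions are walks *)

Local Open Scope nat_scope.

(** The pair whose parts add up to t: [k,k] for t = 2k, [k,k+1] for t = 2k+1.  The state 0
is the convention [0,0] for the absence of a pair. *)
Definition pair_of (t : nat) : seq nat := [:: t./2; uphalf t].

Fixpoint walk_groups (t : nat) (w : seq nat) : seq (seq nat) :=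
  if w is d :: w' then
    (if d == 5 then [:: [:: uphalf t]] else [::])
      ++ pair_of (t + d) :: walk_groups (t + d) w'
  else [::].

Fixpoint is_walk (t : nat) (w : seq nat) : bool :=
  if w is d :: w' then (d \in steps t) && is_walk (t + d) w' else true.

Lemma mem_steps t (d : nat) :
  (d \in steps t) = [|| d == 2, d == 3, d == 4 | odd t && (d == 5)].
Proof. by rewrite /steps mem_cat !inE; case: (odd t); rewrite ?inE ?orbF -?orbA. Qed.

Lemma flatten_groups l : flatten (groups l) = l.
Proof.
have [n] := ubnP (size l); elim: n l => // n IHn [|a [|c l]] //= szl.
case: ifP => _ /=; first by rewrite IHn // -ltnS (leq_trans _ szl).
by rewrite (IHn (c :: l)).
Qed.

Lemma groups_nonempty l : [::] \notin groups l.
Proof.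
have [n] := ubnP (size l); elim: n l => // n IHn [|a [|c l]] //= szl.
case: ifP => _; rewrite inE; last exact: (IHn (c :: l)).
by apply: IHn; rewrite -ltnS (leq_trans _ szl).
Qed.

(** Unlike being the decomposition of a given partition, this passes to suffixes. *)
Definition greedy (s : seq (seq nat)) : bool := groups (flatten s) == s.

Lemma greedy_behead g s : greedy (g :: s) -> greedy s.
Proof.
rewrite /greedy /=; case: g => [|a [|b g]] /= => [/eqP E|/eqP|/eqP].
- by have := groups_nonempty (flatten s); rewrite E mem_head.
- case: (flatten s) => [|c l] /=; first by case=> <-.
  by case: ifP => _ // [<-].
by case: ifP => _ // [<-] /eqP.
Qed.

Lemma greedy_head g s : greedy (g :: s) ->
  exists a, g = [:: a] \/ exists2 t, a = t./2 & g = pair_of t.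
Proof.
rewrite /greedy; case: (flatten (g :: s)) => [|a [|b l]] //=.
  by move=> /eqP[<- _]; exists a; left.
case: ifP => [/orP[]/eqP-> | _] /eqP[<- _]; exists a; [right|right|by left].
  by exists a.*2; rewrite ?doubleK // /pair_of doubleK uphalf_double.
by exists a.*2.+1; rewrite /pair_of /= ?doubleK // uphalf_double.
Qed.

Lemma greedy_single c g s : greedy ([:: c] :: g :: s) -> sorted leq (flatten ([:: c] :: g :: s)) ->
  c.+2 <= head 0 g.
Proof.
move=> gr; have [a Eg] := greedy_head (greedy_behead gr).
have {Eg} [g' Eg] : exists g', g = a :: g'.
  by case: Eg => [->|[t -> ->]]; [exists [::] | exists [:: uphalf t]].
move: gr; rewrite {}Eg /greedy /=; case: ifP => [_ /eqP//|].
move=> /norP[/eqP n1 /eqP n2] _ /andP[lt _]; lia.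
Qed.

Lemma at_most_twiceP l : reflect (forall x, count_mem x l <= 2) (at_most_twice l).
Proof.
apply: (iffP allP) => [H x|H x _ //]; have [/H //|/count_memPn->//] := boolP (x \in l).
Qed.

Definition movable (s1 : seq (seq nat)) (g : seq nat) (s2 : seq (seq nat)) : bool :=
  [&& 0 \notin moved_pair g,
      at_most_twice (flatten s1 ++ moved_pair g ++ flatten s2)
    & nth 0 (last [:: 0; 0] (filter is_pair s1)) 1 <= nth 0 (moved_pair g) 0].

(** [no_backward_move] restricted to the groups of s2, with the prefix s1 explicit, so as
to proceed by induction on s2. *)
Fixpoint none_movable (s1 s2 : seq (seq nat)) : bool :=
  if s2 is g :: s2' then
    (is_pair g ==> ~~ movable s1 g s2') && none_movable (rcons s1 g) s2'
  else true.

Lemma no_backward_moveE s : no_backward_move s = none_movable [::] s.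
Proof.
suff E s1 : all (fun i => is_pair (nth [::] (s1 ++ s) i) ==> ~~ backward_movable (s1 ++ s) i)
    (iota (size s1) (size s)) = none_movable s1 s by exact: (E [::]).
elim: s s1 => [|g s IHs] s1 //=; rewrite -(IHs (rcons s1 g)) cat_rcons size_rcons.
congr (_ && _); rewrite /backward_movable nth_cat ltnn subnn /=.
by rewrite take_size_cat // -cat_rcons drop_size_cat ?size_rcons.
Qed.

Lemma uphalf_eq_half t : (uphalf t == t./2) = ~~ odd t.
Proof. lia. Qed.

Lemma uphalf_eq_halfS t : (uphalf t == t./2.+1) = odd t.
Proof. lia. Qed.

(** A backward move lowers the sum of a pair by 3, and changes its kind. *)
Lemma moved_pairE t : moved_pair (pair_of t) = pair_of (t - 3).
Proof.
rewrite /moved_pair /is_repeating /pair_of /= uphalf_eq_half.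
by case: ifP => ot; congr [:: _; _]; lia.
Qed.

Lemma moved_pair_small t : t <= 4 -> 0 \in moved_pair (pair_of t).
Proof. by case: t => [|[|[|[|[|]]]]]. Qed.

(** All that the possibility of a move depends on before the pair: the last pair, and how
often its larger part, which is the largest part, occurs. *)
Definition prefix_state (s1 : seq (seq nat)) (t : nat) : Prop :=
  [/\ last [:: 0; 0] (filter is_pair s1) = pair_of t,
      forall x, uphalf t < x -> count_mem x (flatten s1) = 0
    & count_mem (uphalf t) (flatten s1) = if t == 0 then 0 else if odd t then 1 else 2].

Lemma prefix_state_nil : prefix_state [::] 0.
Proof. by []. Qed.

Lemma prefix_state_step s1 t (d : nat) : prefix_state s1 t -> d \in steps t ->
  prefix_state (rcons (s1 ++ if d == 5 then [:: [:: uphalf t]] else [::]) (pair_of (t + d))) (t + d).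
Proof.
case=> [lp hi ct]; rewrite mem_steps => dt.
have gt : uphalf t < uphalf (t + d) by clear -dt; lia.
have cs x : uphalf t < x -> count_mem x
    (flatten (s1 ++ if d == 5 then [:: [:: uphalf t]] else [::])) = 0.
  move=> ltx; rewrite flatten_cat count_cat hi //; case: (d == 5) => //=.
  by rewrite (ltn_eqF ltx).
split.
- by rewrite filter_rcons last_rcons.
- move=> x ltx; rewrite flatten_rcons count_cat cs ?(ltn_trans gt) //=.
  by rewrite (ltn_eqF ltx) (_ : (t + d)./2 == x = false) //; clear -ltx; lia.
rewrite flatten_rcons count_cat cs //= eqxx.
rewrite (_ : t + d == 0 = false); last by clear -dt; lia.
by rewrite eq_sym uphalf_eq_half; case: odd.
Qed.

(** From t + 5 on, the moved pair has sum at least t + 2: it is not moved through the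
preceding pair, and if it shares the part uphalf t with the prefix, then t is odd and
this part occurred only once. *)
Lemma movable_far s1 t u s2 : prefix_state s1 t -> t + 5 <= u ->
    at_most_twice (flatten s1 ++ pair_of u ++ flatten s2) ->
    all (leq u./2) (flatten s2) ->
  movable s1 (pair_of u) s2.
Proof.
case=> [lp hi ct] leu /at_most_twiceP tw /allP lo.
rewrite /movable moved_pairE lp; apply/and3P; split.
- by rewrite !inE; clear -leu; lia.
- apply/at_most_twiceP => x; have := tw x; rewrite !count_cat.
  have [ltx|lex] := ltnP x u./2; last first.
    rewrite (hi x) /=; last by clear -lex leu; lia.
    rewrite (_ : (u - 3)./2 == x = false); last by clear -lex leu; lia.
    rewrite (_ : uphalf (u - 3) == x = false); last by clear -lex leu; lia.
    by clear; lia.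
  rewrite (_ : count_mem x (flatten s2) = 0); last first.
    by apply/count_memPn/negP => /lo; rewrite leqNgt ltx.
  rewrite !addn0 => _ /=.
  have [ltxt|] := ltnP (uphalf t) x; first by rewrite hi // add0n addn0 (leq_add (leq_b1 _) (leq_b1 _)).
  rewrite leq_eqVlt => /predU1P[->|ltxt].
    rewrite ct (_ : uphalf (u - 3) == uphalf t = false); last by clear -leu; lia.
    case ot: (odd t); first by case: (t == 0); case: (_ == _).
    rewrite (_ : (u - 3)./2 == uphalf t = false); last by clear -leu ot; lia.
    by case: (t == 0).
  rewrite (_ : (u - 3)./2 == x = false); last by clear -ltxt leu; lia.
  rewrite (_ : uphalf (u - 3) == x = false); last by clear -ltxt leu; lia.
  by rewrite -[X in _ + X]/0 addn0; apply: leq_trans (tw x); rewrite count_cat leq_addr.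
by rewrite /=; clear -leu; lia.
Qed.

Lemma all_leqW i j l : i <= j -> all (leq j) l -> all (leq i) l.
Proof. by move=> leij; apply: sub_all => y; apply: leq_trans. Qed.

Lemma all_sorted_cons x l : sorted leq (x :: l) -> all (leq x) l /\ sorted leq l.
Proof. by rewrite /= (path_sortedE leq_trans) => /andP. Qed.

Lemma singles_spaced c sing t s : 
    greedy ([:: c] :: sing ++ pair_of t :: s) ->
    sorted leq (flatten ([:: c] :: sing ++ pair_of t :: s)) ->
    ~~ has is_pair sing ->
  [/\ all (leq c) (flatten sing), uniq (c :: flatten sing),
      all (fun x => x.+2 <= t./2) (c :: flatten sing)
    & sing != [::] -> c.+4 <= t./2].
Proof.
elim: sing c => [|g sing IHs] c gr so.
  by have /= lec := greedy_single gr so; split=> //=; rewrite lec.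
rewrite /= negb_or => /andP[ng nsing].
have gr' := greedy_behead gr.
have [a [Eg|[u _ Eg]]] := greedy_head gr'; last by rewrite Eg in ng.
rewrite {}Eg {g ng} in gr so gr' *.
have /= leca := greedy_single gr so.
have so' : sorted leq (flatten ([:: a] :: sing ++ pair_of t :: s)).
  by have [] := all_sorted_cons so.
have [le1 un le2 ne] := IHs a gr' so' nsing.
have leta : a.+2 <= t./2 by case/andP: le2.
have le3 : all (leq c.+2) (a :: flatten sing).
  by rewrite /= leca; apply: all_leqW le1.
split.
- by apply: (all_leqW _ le3); apply: leqW (leqnSn c).
- rewrite [uniq _]/= -/(uniq (a :: flatten sing)) un andbT.
  by apply/negP => /(allP le3); rewrite ltnNge leqnSn.
- by apply/andP; split; [clear -leca leta; lia | exact: le2].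
- by move=> _; clear -leca leta; lia.
Qed.

Lemma split_first_pair (s : seq (seq nat)) : has is_pair s ->
  exists s1 g s2, [/\ s = s1 ++ g :: s2, ~~ has is_pair s1 & is_pair g].
Proof.
elim: s => //= g s IHs; case: (boolP (is_pair g)) => [pg _|ng /= /IHs].
  by exists [::], g, s.
by case=> s1 [h [s2 [-> n1 ph]]]; exists (g :: s1), h, s2; split; rewrite //= negb_or ng.
Qed.

(** Singletons are 2 apart from each other and from the pair u, so there is room for
[k-1,k-1], and for [k-2,k-1] unless k-2 is at once the only singleton and the larger
part of the preceding pair: it would then occur three times.  This is the block. *)
Lemma movable_singles s1 t c sing u s2 : prefix_state s1 t -> 
    greedy ([:: c] :: sing ++ pair_of u :: s2) ->
    sorted leq (flatten ([:: c] :: sing ++ pair_of u :: s2)) ->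
    ~~ has is_pair sing -> t./2.+1 <= c ->
    at_most_twice (flatten s1 ++ flatten ([:: c] :: sing ++ pair_of u :: s2)) ->
    ~~ [&& odd t, c == uphalf t, sing == [::] & u == t + 5] ->
  movable (s1 ++ [:: c] :: sing) (pair_of u) s2.
Proof.
case=> [lp hi ct] gr so nsing lec /at_most_twiceP tw nblock.
have [le1 un /allP le2 ne] := singles_spaced gr so nsing.
have lecu : c.+2 <= u./2 by apply: le2; rewrite mem_head.
have tc : uphalf t <= c by apply: leq_trans lec; clear; lia.
have lo : all (leq u./2) (flatten s2).
  have : sorted leq (flatten (pair_of u :: s2)).
    have : suffix (flatten (pair_of u :: s2)) (flatten ([:: c] :: sing ++ pair_of u :: s2)).
      by rewrite -cat_cons flatten_cat suffix_suffix.
    by case/suffixP=> l E; move: so; rewrite E => /(subseq_sorted leq_trans (suffix_subseq _ _)).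
  by case/all_sorted_cons=> /andP[_].
rewrite /movable moved_pairE.
have -> : filter is_pair (s1 ++ [:: c] :: sing) = filter is_pair s1.
  rewrite filter_cat /= [X in _ ++ X](_ : _ = [::]) ?cats0 //.
  by apply/eqP; rewrite -(negbK (_ == _)) -has_filter.
rewrite lp; apply/and3P; split.
- by rewrite !inE; clear -lecu lec; lia.
- have Eflat : flatten ([:: c] :: sing ++ pair_of u :: s2) = (c :: flatten sing) ++ pair_of u ++ flatten s2.
    by rewrite /= flatten_cat.
  have Eflat1 : flatten (s1 ++ [:: c] :: sing) = flatten s1 ++ c :: flatten sing.
    by rewrite flatten_cat.
  have leM x : x \in c :: flatten sing -> c <= x /\ x.+2 <= u./2.
    by move=> xm; split; [move: xm; rewrite inE => /predU1P[->|/(allP le1)] | apply: le2].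
  have eqM : c.+2 = u./2 -> sing = [::].
    by move=> Ec; apply/eqP; apply: contraT => /ne lec4; clear -lec4 Ec; lia.
  apply/at_most_twiceP => x; have := tw x; rewrite Eflat Eflat1.
  move: (c :: flatten sing) (mem_head c (flatten sing)) un leM => M cM un leM.
  rewrite !count_cat (count_uniq_mem _ un) => twx.
  have [lex|ltx] := leqP u./2 x.
    rewrite (_ : count_mem x (pair_of (u - 3)) = 0).
      apply: leq_trans twx; rewrite -addnA leq_add2l leq_add2l; exact: leq_addl.
    rewrite /= (_ : (u - 3)./2 == x = false); last by clear -lex lecu; lia.
    by rewrite (_ : uphalf (u - 3) == x = false); last by clear -lex lecu; lia.
  rewrite (_ : count_mem x (flatten s2) = 0); last first.
    by apply/count_memPn/negP => /(allP lo); rewrite leqNgt ltx.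
  rewrite addn0 /=.
  have [xM|xM] := boolP (x \in M); last first.
    rewrite addn0.
    have [ltxt|lext] := ltnP (uphalf t) x.
      by rewrite hi //; do 2!case: (_ == x).
    rewrite (_ : uphalf (u - 3) == x = false); last by clear -lext lecu tc; lia.
    have nxc : x <> c by move=> Ex; rewrite Ex cM in xM.
    rewrite (_ : (u - 3)./2 == x = false); last by clear -lext lecu tc nxc; lia.
    by rewrite !addn0 in twx *; apply: leq_trans twx; rewrite -addnA leq_addr.
  have [lecx ltxu] := leM _ xM.
  rewrite (_ : uphalf (u - 3) == x = false); last by clear -ltxu; lia.
  have [ltxt|lext] := ltnP (uphalf t) x; first by rewrite hi //; case: (_ == x).
  (* x would be the larger part of the last pair as well as the first singleton *)
  have Ecx : c = x by clear -lecx tc lext; lia.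
  have Ect : c = uphalf t by clear -lecx tc lext; lia.
  have ot : odd t by clear -Ect lec; lia.
  have t0 : t == 0 = false by clear -ot; lia.
  rewrite -Ecx Ect ct ot t0.
  case: eqP => // Eu; case/negP: nblock.
  have Ecu : c.+2 = u./2 by clear -Eu ltxu Ecx Ect; lia.
  rewrite ot Ect eqxx (eqM Ecu) eqxx /=; clear -Ecu Ect ot Eu; lia.
by rewrite /=; clear -lecu tc; lia.
Qed.

Lemma none_movable_catr s1 a b : none_movable s1 (a ++ b) -> none_movable (s1 ++ a) b.
Proof.
elim: a s1 => [|g a IHa] s1 /=; first by rewrite cats0.
by case/andP=> _ /IHa; rewrite cat_rcons.
Qed.

Lemma greedy_catr a b : greedy (a ++ b) -> greedy b.
Proof. by elim: a => //= g a IHa /greedy_behead. Qed.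

(** A repeated part cannot occur a third time. *)
Lemma after_pair_ge u s l : sorted leq (flatten (pair_of u :: s)) ->
    at_most_twice (l ++ flatten (pair_of u :: s)) ->
  all (leq u./2.+1) (flatten s).
Proof.
rewrite /= => /andP[_]; rewrite (path_sortedE leq_trans) => /andP[/allP ge _].
move=> /at_most_twiceP/(_ u./2); rewrite count_cat /= eqxx => tw.
apply/allP=> y ys; have := ge y ys; rewrite ltn_neqAle => ley.
apply/andP; split; last by apply: leq_trans ley; clear; lia.
apply/eqP=> Ey; have eu : uphalf u == u./2 by clear -ley Ey; lia.
have : 0 < count_mem u./2 (flatten s) by rewrite -has_count has_pred1 Ey.
by move: tw; rewrite eu addnC; case: (count_mem _ (flatten s)).
Qed.

(** The next pair lies at least 2 further, as parts occur at most twice and groups are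
formed greedily.  Without singletons before it, [movable_far] leaves the steps 2, 3, 4;
with singletons, [movable_singles] leaves only the step 5. *)
Lemma walk_of_groups s2 s1 t : prefix_state s1 t -> greedy s2 ->
    sorted leq (flatten s2) -> all (leq t./2.+1) (flatten s2) ->
    at_most_twice (flatten s1 ++ flatten s2) -> none_movable s1 s2 ->
    (s2 == [::]) || is_pair (last [::] s2) ->
  exists2 w, is_walk t w & s2 = walk_groups t w.
Proof.
have [n] := ubnP (size s2); elim: n s2 s1 t => // n IHn [|g s2] s1 t /=.
  by exists [::].
rewrite ltnS => szs st gr so lo tw nm lastp.
have [c [Eg|[u _ Eg]]] := greedy_head gr; rewrite {g}Eg in gr so lo tw nm lastp *.
  have hp : has is_pair s2.
    case/lastP: s2 lastp {szs gr so lo tw nm} => [|s2 h] //.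
    by rewrite last_rcons has_rcons => ->.
  have [sing [h [s3 [Es nsing ph]]]] := split_first_pair hp.
  rewrite {s2}Es in szs gr so lo tw nm lastp hp *.
  have [a [Eh|[u _ Eh]]] := greedy_head (greedy_catr (greedy_behead gr)).
    by rewrite Eh in ph.
  rewrite {h}Eh in szs gr so lo tw nm lastp hp ph *.
  have [/and4P[ot /eqP Ec /eqP Esing /eqP Eu]|nblock] :=
      boolP [&& odd t, c == uphalf t, sing == [::] & u == t + 5]; last first.
    have nm' := none_movable_catr (nm : none_movable s1 (([:: c] :: sing) ++ pair_of u :: s3)).
    case/andP: nm' => nm' _; move: nm'.
    rewrite /= (movable_singles st gr so nsing _ _ nblock) //.
    by case/andP: lo.
  rewrite {sing nsing}Esing {c}Ec {u}Eu in szs gr so lo tw nm lastp hp ph *.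
  have d5 : 5 \in steps t by rewrite mem_steps ot orbT.
  have st' := prefix_state_step st d5; rewrite /= in st'.
  have [_ so'] := all_sorted_cons
    (so : sorted leq (uphalf t :: flatten (pair_of (t + 5) :: s3))).
  have tw' : at_most_twice ((flatten s1 ++ [:: uphalf t]) ++ flatten (pair_of (t + 5) :: s3)).
    by rewrite -catA.
  have [|||||| w wP Ew] := IHn s3 _ _ (ltnW szs) st'.
  - exact: greedy_behead (greedy_behead gr).
  - by case/all_sorted_cons: so' => _ /all_sorted_cons[].
  - exact: after_pair_ge so' tw'.
  - by rewrite flatten_rcons flatten_cat -[(_ ++ _) ++ flatten s3]catA; exact: tw'.
  - by move: nm => /andP[_ /andP[_]]; rewrite cats1.
  - by move: lastp; case: (s3).
  by exists (5 :: w); rewrite /= ?d5 ?wP // Ew.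
have lo' := after_pair_ge so tw.
(* u = t + 1 would make the larger part of the last pair occur three times *)
have geu : t + 2 <= u.
  rewrite leqNgt; apply/negP => ltu.
  have ltu2 : t./2.+1 <= u./2 by case/andP: lo.
  have Eu : u = t.+1 by clear -ltu ltu2; lia.
  have ot : odd t by clear -ltu2 Eu; lia.
  case: st => _ _; have := at_most_twiceP _ tw (uphalf t).
  rewrite count_cat /= Eu (_ : t.+1./2 == uphalf t) // (_ : uphalf t.+1 == uphalf t) ?ot; last first.
    by clear -ot; lia.
  by move=> /[swap] ->; clear -ot; case: t ot.
have ltu : u < t + 5.
  rewrite ltnNge; apply/negP => leu; case/andP: nm; rewrite /= => /negP[].
  by apply: movable_far st leu tw _; apply: all_leqW lo'.
have [d Ed] : exists d, u = t + d by exists (u - t); rewrite subnKC //; clear -geu; lia.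
rewrite {u}Ed in gr so lo tw nm lastp lo' geu ltu *.
have dt : d \in steps t by rewrite mem_steps; clear -geu ltu; lia.
have d5 : d == 5 = false by clear -ltu; lia.
have st' := prefix_state_step st dt; rewrite d5 cats0 in st'.
have [|||||| w wP Ew] := IHn s2 _ _ szs st'.
- exact: greedy_behead gr.
- by case/all_sorted_cons: so => _ /all_sorted_cons[].
- exact: lo'.
- by rewrite flatten_rcons -catA.
- by case/andP: nm.
- by move: lastp; case: (s2).
by exists (d :: w); rewrite /= ?dt ?wP // d5 Ew.
Qed.

(** The moved pair has sum t - 1, t, t + 1 (or t + 2 for a block): it would contain a
part 0, or pass through the preceding pair, or uphalf t would occur three times. *)
Lemma immovable_step s1 t (d : nat) s2 : prefix_state s1 t -> d \in steps t ->
  ~~ movable (s1 ++ if d == 5 then [:: [:: uphalf t]] else [::]) (pair_of (t + d)) s2.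
Proof.
case=> [lp hi ct]; rewrite mem_steps => dt; apply/negP => /and3P[].
have [small|big] := leqP (t + d) 4; first by rewrite moved_pair_small.
rewrite moved_pairE => _ /at_most_twiceP/(_ (uphalf t)) tw.
have -> : filter is_pair (s1 ++ if d == 5 then [:: [:: uphalf t]] else [::]) = filter is_pair s1.
  by rewrite filter_cat; case: (d == 5); rewrite cats0.
rewrite lp /= leqNgt => /negP[].
move: tw; rewrite flatten_cat !count_cat ct.
rewrite (_ : t == 0 = false) /=; last by clear -big dt; lia.
set c2 := count_mem _ (flatten s2); move: c2 => c2.
case: (d =P 5) dt => [-> dt|_ dt] /=; rewrite ?eqxx.
  have ot : odd t by clear -dt; lia.
  rewrite ot (_ : (t + 5 - 3)./2 == uphalf t); last by clear -ot; lia.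
  by [].
case ot: (odd t).
  have [d4|] := eqVneq d 4.
    rewrite d4 (_ : (t + 4 - 3)./2 == uphalf t); last by clear -ot; lia.
    by rewrite (_ : uphalf (t + 4 - 3) == uphalf t) //; clear -ot; lia.
  by move=> d4 _; clear -dt d4 ot big; lia.
have [d2|d2] := eqVneq d 2; first by move=> _; clear -d2 big; lia.
rewrite (_ : (t + d - 3)./2 == uphalf t) //; clear -dt ot d2 big; lia.
Qed.

Lemma walk_immovable s1 t w : prefix_state s1 t -> is_walk t w ->
  none_movable s1 (walk_groups t w).
Proof.
elim: w s1 t => //= d w IHw s1 t st /andP[dt wP].
have nm s2 := immovable_step s2 st dt; have := prefix_state_step st dt.
case: (d == 5) nm => /= nm st'.
  by rewrite -cats1 nm /= IHw.
by rewrite !cats0 in nm st' *; rewrite nm /= IHw.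
Qed.

Lemma walk_greedy t w : is_walk t w -> greedy (walk_groups t w).
Proof.
elim: w t => //= d w IHw t /andP[dt /IHw/eqP gr]; rewrite /greedy.
have pE l : groups ((t + d)./2 :: uphalf (t + d) :: l) = pair_of (t + d) :: groups l.
  by rewrite /= (_ : _ || _) //; clear; lia.
rewrite mem_steps in dt.
case: (d =P 5) dt => [-> dt|_ dt] in pE gr *; last by rewrite [flatten _]/= pE gr.
rewrite [flatten _]/= -[groups _]/(if _ then _ else [:: uphalf t] :: groups (_ :: uphalf (t + 5) :: _)).
by rewrite pE gr (_ : _ || _ = false) //; clear -dt; lia.
Qed.

Lemma walk_ge t w : is_walk t w -> all (leq t./2.+1) (flatten (walk_groups t w)).
Proof.
elim: w t => //= d w IHw t /andP[]; rewrite mem_steps => dt /IHw lo.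
have lo' : all (leq t./2.+1) ((t + d)./2 :: uphalf (t + d) :: flatten (walk_groups (t + d) w)).
  apply/and3P; split; try by clear -dt; lia.
  by apply: all_leqW lo; clear -dt; lia.
case: (d =P 5) dt => [-> dt|_ _] in lo' *; last exact: lo'.
by apply/andP; split; [clear -dt; lia | exact: lo'].
Qed.

Lemma walk_sorted t w : is_walk t w -> sorted leq (flatten (walk_groups t w)).
Proof.
elim: w t => //= d w IHw t /andP[]; rewrite mem_steps => dt wP.
have so : sorted leq ((t + d)./2 :: uphalf (t + d) :: flatten (walk_groups (t + d) w)).
  rewrite /= (path_sortedE leq_trans) IHw // andbT.
  apply/andP; split; first by clear; lia.
  by apply: all_leqW (walk_ge wP); clear; lia.
case: (d =P 5) dt => [-> dt|_ _] in so *; last exact: so.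
by apply/andP; split; [clear -dt; lia | exact: so].
Qed.

Lemma count_lt_all x y l : x < y -> all (leq y) l -> count_mem x l = 0.
Proof.
by move=> ltxy /allP ge; apply/count_memPn/negP => /ge; rewrite leqNgt ltxy.
Qed.

(** After a pair [L-1,L] the part L may occur once more, but not twice. *)
Lemma walk_count_first t w : odd t -> is_walk t w ->
  count_mem (uphalf t) (flatten (walk_groups t w)) <= 1.
Proof.
case: w => //= d w ot /andP[]; rewrite mem_steps => dt wP.
have c0 : count_mem (uphalf t) (flatten (walk_groups (t + d) w)) = 0.
  by apply: count_lt_all (walk_ge wP); clear -dt; lia.
have n2 : uphalf (t + d) == uphalf t = false by clear -dt; lia.
rewrite flatten_cat count_cat /= c0 n2.
case: (d =P 5) dt => [-> dt|_ dt] /=; last by case: (_ == _).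
by rewrite eqxx (_ : _ == _ = false) //; clear -ot; lia.
Qed.

Lemma walk_at_most_twice t w : is_walk t w -> at_most_twice (flatten (walk_groups t w)).
Proof.
elim: w t => //= d w IHw t /andP[]; rewrite mem_steps => dt wP.
apply/at_most_twiceP => x; rewrite flatten_cat count_cat [count _ (flatten (_ :: _))]/=.
have tw : ((t + d)./2 == x) + ((uphalf (t + d) == x) +
    count_mem x (flatten (walk_groups (t + d) w))) <= 2.
  have [lex|ltx] := leqP x (t + d)./2.
    by rewrite (count_lt_all _ (walk_ge wP)) //; do 2!case: (_ == x).
  rewrite (_ : (t + d)./2 == x = false) ?(ltn_eqF ltx) // add0n.
  have [Ex|nx] := eqVneq (uphalf (t + d)) x.
    rewrite -Ex -[2]/(1 + 1) leq_add //; apply: walk_count_first wP; clear -Ex ltx; lia.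
  by apply: (at_most_twiceP _ (IHw _ wP)).
case: (d =P 5) dt => [Ed dt|_ _] //=; rewrite addn0.
have [Ex|nx] := eqVneq (uphalf t) x; last exact: tw.
rewrite (count_lt_all _ (walk_ge wP)) //; last by clear -Ex Ed; lia.
rewrite (_ : uphalf (t + d) == x = false); first by case: (_ == _).
by clear -Ex Ed; lia.
Qed.

Lemma moveable_singletons_nil s : [::] \notin s ->
  (moveable_singletons s == [::]) = (s == [::]) || is_pair (last [::] s).
Proof.
case/lastP: s => // s g; rewrite mem_rcons inE negb_or => /andP[g0 _].
have -> : (rcons s g == [::]) = false by case: (s).
rewrite last_rcons /= /moveable_singletons rev_rcons /=.
case: (is_pair g) => //=; rewrite rev_cons flatten_rcons -size_eq0 size_cat.
by rewrite addn_eq0 andbC size_eq0 eq_sym (negPf g0).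
Qed.

Lemma walk_groups_nonempty t w : [::] \notin walk_groups t w.
Proof.
elim: w t => //= d w IHw t; rewrite mem_cat inE negb_or IHw andbT.
by case: (d == 5).
Qed.

Lemma last_walk_groups t w : w != [::] -> last [::] (walk_groups t w) = pair_of (t + sumn w).
Proof.
elim: w t => //= d w IHw t _; rewrite last_cat /=.
case: w IHw => [|d' w] IHw; first by rewrite addn0.
have := IHw (t + d) isT; rewrite -addnA => <-.
have : walk_groups (t + d) (d' :: w) != [::] by rewrite /=; case: (d' == 5).
by case: (walk_groups _ _).
Qed.

Lemma has_pair_walk t w : has is_pair (walk_groups t w) = (w != [::]).
Proof. by case: w => //= d w; rewrite has_cat /= orbT. Qed.

Lemma last_pair_part_walk w : last_pair_part (walk_groups 0 w) = (sumn w)./2.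
Proof.
rewrite /last_pair_part; have [->//|w0] := eqVneq w [::].
have := last_walk_groups 0 w0; case/lastP: (walk_groups 0 w) => // s g.
by rewrite last_rcons => ->; rewrite filter_rcons /= last_rcons.
Qed.

Lemma base_walkP b :
  reflect (exists w, [/\ is_walk 0 w, w != [::] & b = flatten (walk_groups 0 w)])
    [&& is_base b, moveable_singletons (groups b) == [::] & has is_pair (groups b)].
Proof.
apply: (iffP and3P) => [[]|[w [wP w0 ->]]].
  rewrite /is_base no_backward_moveE => /and4P[/andP[so b0] tw nm _] mo hp.
  have [|||||w wP Ew] := walk_of_groups prefix_state_nil _ _ _ _ nm _.
  - by rewrite /greedy flatten_groups.
  - by rewrite flatten_groups.
  - by rewrite flatten_groups; apply/allP=> -[|x] //; rewrite (negPf b0).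
  - by rewrite flatten_groups.
  - by rewrite -moveable_singletons_nil // groups_nonempty.
  exists w; split=> //; last by rewrite -Ew flatten_groups.
  by rewrite -(has_pair_walk 0) -Ew.
have Eg : groups (flatten (walk_groups 0 w)) = walk_groups 0 w by apply/eqP/walk_greedy.
rewrite Eg; have mo : moveable_singletons (walk_groups 0 w) == [::].
  by rewrite moveable_singletons_nil ?walk_groups_nonempty // last_walk_groups ?orbT.
split=> //; last by rewrite has_pair_walk.
rewrite /is_base Eg (eqP mo) /= no_backward_moveE (walk_immovable prefix_state_nil wP).
rewrite /is_partition walk_sorted // walk_at_most_twice // !andbT /=.
by apply/negP => /(allP (walk_ge wP)).
Qed.

Lemma block_count_cons g s : block_count (g :: s) = is_block (g :: s) 0 + block_count s.
Proof.
by rewrite /block_count /= (iotaDl 1 0) count_map.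
Qed.

Lemma is_block0 s : is_block s 0 ->
  exists a s', s = [:: [:: a; a.+1], [:: a.+1], [:: a.+3; a.+3] & s'].
Proof.
rewrite /is_block drop0.
case: s => [|g1 [|g2 [|g3 s]]]; [by move/eqP | by move/eqP | by move/eqP |].
by move=> /eqP[E1 -> -> _]; exists (nth 0 g1 0), s; rewrite {1}E1.
Qed.

Lemma in_block_head g s : in_block (g :: s) 0 = is_block (g :: s) 0.
Proof.
rewrite /in_block /= andbT orb_idr // => /hasP[j].
by rewrite mem_iota => /andP[j0 _] /andP[_ /andP[]]; case: j j0.
Qed.

Lemma in_block_cons g s i :
  in_block (g :: s) i.+1 = is_block (g :: s) 0 && (i < 2) || in_block s i.
Proof. by rewrite /in_block /= (iotaDl 1 0) has_map. Qed.

Definition free_pair_count (s : seq (seq nat)) : nat :=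
  count (fun i => is_pair (nth [::] s i) && ~~ in_block s i) (iota 0 (size s)).

Lemma free_pair_count_cons g s : is_block (g :: s) 0 = false ->
  free_pair_count (g :: s) = is_pair g + free_pair_count s.
Proof.
move=> nb; rewrite /free_pair_count /= in_block_head nb andbT; congr (_ + _).
rewrite (iotaDl 1 0) count_map; apply: eq_count => i /=.
by rewrite in_block_cons nb.
Qed.

Lemma free_pair_count_block g1 g2 g3 s : is_block [:: g1, g2, g3 & s] 0 ->
  free_pair_count [:: g1, g2, g3 & s] = free_pair_count s.
Proof.
move=> b0; have [a [s' [E1 E2 E3 _]]] := is_block0 b0.
have b1 : is_block [:: g2, g3 & s] 0 = false by apply/negP => /is_block0[c [t []]]; rewrite E2.
have b2 : is_block [:: g3 & s] 0 = false.
  apply/negP => /is_block0[c [t []]]; rewrite E3 => -[<-] /eqP.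
  by rewrite eqn_leq ltnn andbF.
rewrite /free_pair_count /= in_block_head !in_block_cons !in_block_head b0 b1 b2 !andbF /=.
rewrite (iotaDl 3 0) count_map; apply: eq_count => i /=.
by rewrite !in_block_cons b1 b2 !andbF.
Qed.

(** Blocks do not overlap, as they start with successive parts and end with equal ones;
each contains two pairs. *)
Lemma free_pair_countE s : free_pair_count s + 2 * block_count s = count is_pair s.
Proof.
have [n] := ubnP (size s); elim: n s => // n IHn [|g s] //=; rewrite ltnS => szs.
case b0: (is_block (g :: s) 0); last first.
  by rewrite free_pair_count_cons // block_count_cons b0 add0n -addnA IHn.
have [a [s' [Eg Es]]] := is_block0 b0; subst g s.
rewrite free_pair_count_block // !block_count_cons b0.
have -> : is_block [:: [:: a.+1], [:: a.+3; a.+3] & s'] 0 = false.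
  by apply/negP => /is_block0[c [t []]].
have -> : is_block [:: [:: a.+3; a.+3] & s'] 0 = false.
  apply/negP => /is_block0[c [t []]] -[<-] /eqP.
  by rewrite eqn_leq ltnn andbF.
rewrite /= -(IHn s') //; last exact: leq_trans (leqnSn _) (ltnW szs).
by rewrite !add0n mulnDr addnCA.
Qed.

Lemma count_pair_walk t w : count is_pair (walk_groups t w) = size w.
Proof.
elim: w t => //= d w IHw t; rewrite count_cat /= IHw.
by case: (d == 5).
Qed.

Lemma free_countE w :
  free_repeating_count (walk_groups 0 w) + free_successive_count (walk_groups 0 w)
    + 2 * block_count (walk_groups 0 w) = size w.
Proof.
rewrite -[size w](count_pair_walk 0) -free_pair_countE; congr (_ + _).
have : all (fun g => is_pair g ==> is_repeating g (+) is_successive g) (walk_groups 0 w).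
  elim: w 0 => //= d w IHw t; rewrite all_cat /= IHw andbT.
  rewrite /is_repeating /is_successive /= uphalf_eq_half uphalf_eq_halfS.
  by case: (d == 5); case: odd.
move: (walk_groups 0 w) => s /allP H.
rewrite -count_predUI [X in _ + X](_ : _ = 0); last first.
  apply/eqP; rewrite -leqn0 leqNgt -has_count; apply/hasP => -[i].
  rewrite mem_iota add0n => /andP[_ lti] /= /andP[/andP[ri _] /andP[si _]].
  have := H _ (mem_nth [::] lti); rewrite ri si.
  by case/andP: ri => ->.
rewrite addn0; apply: eq_in_count => i; rewrite mem_iota add0n => /andP[_ lti] /=.
have := H _ (mem_nth [::] lti); rewrite /is_repeating /is_successive.
by case: is_pair => //=; case: (_ == _); case: (_ == _); case: in_block.
Qed.

Lemma block_count_walk w : is_walk 0 w -> block_count (walk_groups 0 w) = count_mem 5 w.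
Proof.
have E t v : is_walk t v -> block_count (pair_of t :: walk_groups t v) = count_mem 5 v.
  elim: v t => [|d v IHv] t /=.
    by rewrite block_count_cons /is_block /= eqseq_cons andbF.
  case/andP; rewrite mem_steps => dt vP; rewrite -(IHv (t + d)) // block_count_cons.
  case: (d =P 5) dt => [-> dt|d5 dt]; rewrite [_ ++ _]/=.
    rewrite block_count_cons addnA; congr (_ + _).
    have -> : is_block [:: [:: uphalf t], pair_of (t + 5) & walk_groups (t + 5) v] 0 = false.
      by apply/negP => /is_block0[c [s' []]].
    rewrite addn0; have -> // : is_block [:: pair_of t, [:: uphalf t], pair_of (t + 5) & walk_groups (t + 5) v] 0.
    rewrite /is_block /= take0 !eqseq_cons !andbT /= eqxx /=.
    by apply/and3P; split; clear -dt; lia.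
  by rewrite (_ : is_block _ 0 = false) //; apply/negP => /is_block0[c [s' []]].
move=> wP; rewrite -(E 0) // block_count_cons.
(* pair_of 0 is [0, 0], which cannot open a block *)
by case: w wP.
Qed.

Fixpoint walks (p t : nat) : seq (seq nat) :=
  if p is p'.+1 then
    flatten [seq [seq d :: w | w <- walks p' (t + d)] | d <- steps t]
  else [:: [::]].

Lemma walksS p t :
  walks p.+1 t = flatten [seq [seq d :: w | w <- walks p (t + d)] | d <- steps t].
Proof. by []. Qed.

Lemma mem_walks p t w : (w \in walks p t) = (size w == p) && is_walk t w.
Proof.
elim: p t w => [|p IHp] t w; first by case: w.
rewrite walksS; apply/idP/idP => [/flattenP[_ /mapP[d dt ->] /mapP[v]]|].
  by rewrite IHp => /andP[szv vP] -> /=; rewrite eqSS szv dt.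
case: w => // d w; rewrite [_ && _]/= eqSS => /and3P[szw dt wP]; apply/flattenP.
exists [seq d :: v | v <- walks p (t + d)]; first by apply/mapP; exists d.
by apply/mapP; exists w; rewrite // IHp szw.
Qed.

Lemma steps_uniq t : uniq (steps t).
Proof. by rewrite /steps; case: (odd t). Qed.

Lemma walks_uniq p t : uniq (walks p t).
Proof.
elim: p t => [|p IHp] t //; rewrite walksS; elim: (steps t) (steps_uniq t) => //= d l IHl /andP[dl ul].
rewrite cat_uniq IHl // andbT map_inj_uniq ?IHp //=; last by move=> v v' [].
apply/hasP => -[w /flattenP[_ /mapP[d' d'l ->] /mapP[v _ ->]] /mapP[v' _ [Ed _]]].
by rewrite -Ed d'l in dl.
Qed.

(** * Collecting the summands *)

Local Open Scope ring_scope.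

Definition walk_parts (w : seq nat) : seq nat := flatten (walk_groups 0 w).

Definition walk_stats (m1 m2 m3 m : nat) (w : seq nat) : bool :=
  [&& free_repeating_count (walk_groups 0 w) == m1,
      free_successive_count (walk_groups 0 w) == m2,
      count_mem 5%N w == m3 & (sumn w)./2 == m].

Lemma half_uphalf t : (t./2 + uphalf t = t)%N.
Proof. lia. Qed.

(** The sums of the pairs determine the steps. *)
Lemma walk_groups_inj t : injective (walk_groups t).
Proof.
move=> w; elim: w t => [|d w IHw] t [|d' w'] //=; try by case: (_ == _).
have dd a b : pair_of (t + a) = pair_of (t + b) -> a = b.
  case=> E1 E2; apply: (@addnI t).
  by rewrite -[LHS]half_uphalf -[RHS]half_uphalf E1 E2.
case: eqP => [->|_]; case: eqP => [->|_] //= E.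
  by case: E => /IHw->.
have Ed : d = d' by apply: dd; case: E => E1 E2 _; rewrite /pair_of E1 E2.
by move: E; rewrite -Ed => -[/IHw->].
Qed.

Lemma walk_parts_inj w w' :
  is_walk 0 w -> is_walk 0 w' -> walk_parts w = walk_parts w' -> w = w'.
Proof.
move=> wP w'P E; apply: (@walk_groups_inj 0).
by rewrite -(eqP (walk_greedy wP)) -(eqP (walk_greedy w'P)); congr groups.
Qed.

Lemma P_base_walks (m1 m2 m3 m : nat) (b : seq nat) : (0 < m1 + m2 + m3)%N ->
  P_base m1 m2 m3 m b =
    (b \in [seq walk_parts w | w <- walks (m1 + m2 + 2 * m3) 0 & walk_stats m1 m2 m3 m w]).
Proof.
move=> pos; apply/idP/mapP => [|[w]].
  case/and5P=> ba mo /eqP b3 /eqP b1 /and3P[/eqP b2 hp /eqP lp].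
  have : [&& is_base b, moveable_singletons (groups b) == [::] & has is_pair (groups b)].
    by rewrite ba mo hp.
  case/base_walkP=> w [wP w0 Eb].
  have Eg : groups b = walk_groups 0 w by rewrite Eb; apply/eqP/walk_greedy.
  move: b1 b2 b3 lp; rewrite {}Eg last_pair_part_walk => b1 b2 b3 lp.
  exists w => //; rewrite mem_filter mem_walks wP andbT /walk_stats b1 b2 lp.
  by rewrite -block_count_walk // b3 !eqxx /= -free_countE b1 b2 b3.
rewrite mem_filter mem_walks => /andP[/and4P[/eqP b1 /eqP b2 /eqP b3 /eqP lp]].
case/andP=> /eqP szw wP Eb.
have w0 : w != [::] by apply: contraTneq pos => w0; move: szw; rewrite w0 /=; lia.
have Eg : groups b = walk_groups 0 w by rewrite Eb; apply/eqP/walk_greedy.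
have : [&& is_base b, moveable_singletons (groups b) == [::] & has is_pair (groups b)].
  by apply/base_walkP; exists w.
case/and3P=> ba mo hp; rewrite /P_base ba mo hp /= Eg last_pair_part_walk.
by rewrite block_count_walk // b1 b2 b3 lp !eqxx.
Qed.

(** The m_i are determined by the walk, and its number of steps is m1 + m2 + 2 m3. *)
Lemma P_walks (m1 m2 m3 m : nat) :
  P m1 m2 m3 (m%:Z + 1) =
  \sum_(w <- walks (m1 + m2 + 2 * m3) 0 | walk_stats m1 m2 m3 m w) 'X^(sumn (walk_parts w)).
Proof.
rewrite /P addrK; case: ifP => [/and3P[/eqP-> /eqP-> /eqP->]|pos].
  rewrite /= big_cons big_nil /walk_stats.
  case: m => [|m]; first by rewrite /= addr0 expr0.
  by have -> : (m.+1%:Z + 1 == 1 :> int) = false by apply/negbTE; rewrite -[X in _ == X]add0r (inj_eq (addIr _)).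
pose L := [seq map val (val b) | b <- index_enum {bseq (2 * m.+1)%N of 'I_m.+2}
  & P_base m1 m2 m3 m (map val (val b))].
pose L' := [seq walk_parts w | w <- walks (m1 + m2 + 2 * m3) 0 & walk_stats m1 m2 m3 m w].
transitivity (\sum_(s <- L) 'X^(sumn s) : {poly int}).
  by rewrite big_map big_filter.
transitivity (\sum_(s <- L') 'X^(sumn s) : {poly int}); last by rewrite big_map big_filter.
apply: perm_big; apply: uniq_perm.
- rewrite map_inj_uniq ?filter_uniq ?index_enum_uniq // => b b' /(inj_map val_inj); exact: val_inj.
- rewrite map_inj_in_uniq ?filter_uniq ?walks_uniq // => w w'.
  rewrite !mem_filter !mem_walks => /and3P[_ _ wP] /and3P[_ _ w'P].
  exact: walk_parts_inj.
move=> s; rewrite -P_base_walks; last by move: pos; clear; lia.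
apply/mapP/idP => [[b + ->]|Ps]; first by rewrite mem_filter => /andP[].
have /andP[les szs] := P_base_bound Ps.
have szb : (size (map (@inord m.+1) s) <= 2 * m.+1)%N by rewrite size_map.
have Eb : map val (Bseq szb) = s.
  rewrite /= -map_comp map_id_in // => x xs /=; rewrite inordK // ltnS.
  exact: (allP les).
by exists (Bseq szb); rewrite ?mem_filter ?mem_index_enum ?Eb ?Ps.
Qed.

Lemma sumn_walk_groups t d w : sumn (flatten (walk_groups t (d :: w))) =
  (step_weight t d + sumn (flatten (walk_groups (t + d) w)))%N.
Proof.
rewrite /= flatten_cat sumn_cat /= (addnA (t + d)./2) half_uphalf addnA /step_weight.
by case: (d == 5%N); rewrite /= ?addn0.
Qed.

Lemma walk_gf_sum (F : fieldType) (q : F) p t M : walk_gf q p t M =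
  \sum_(w <- walks p t) q ^+ sumn (flatten (walk_groups t w)) *
    lag (2 * size w + count_mem 5%N w) (singletons_gf q (t + sumn w)) M.
Proof.
elim: p t M => [|p IHp] t M; first by rewrite big_seq1 /= !addn0 muln0 mul1r.
rewrite walksS big_flatten big_map /=; apply: eq_bigr => d _.
rewrite big_map (lag_eq (g := fun M => \sum_(w <- walks p (t + d))
    q ^+ sumn (flatten (walk_groups (t + d) w)) *
    lag (2 * size w + count_mem 5%N w) (singletons_gf q (t + d + sumn w)) M)) //.
rewrite lag_sum mulr_sumr; apply: eq_bigr => w _.
rewrite sumn_walk_groups lagM lag_lag mulrA -exprD -addnA; congr (_ * lag _ _ _).
by rewrite /step_length /=; case: (d == 5%N); lia.
Qed.

Section BoxSum.
Variables (F : fieldType) (q : F).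

Definition delta (a n : nat) : F := if n == a then 1 else 0.

Lemma lag_delta b a n : lag b (delta a) n = if n == (b + a)%N then 1 else 0.
Proof. by elim: b n => [|b IHb] [|n] //; rewrite lagSS IHb. Qed.

Lemma sum_iota_pick (R : nmodType) (B a : nat) (f : nat -> R) : (a < B)%N ->
  \sum_(i <- iota 0 B) (if i == a then f i else 0) = f a.
Proof.
move=> aB; rewrite (bigD1_seq a) ?mem_iota ?iota_uniq //= eqxx.
by rewrite big1 ?addr0 // => i /negPf->.
Qed.

Lemma lag_delta_sum (f : nat -> F) r n B : (n < B)%N ->
  lag r f n = \sum_(a <- iota 0 B) f a * delta (r + a) n.
Proof.
move=> nB; have [ltnr|lern] := ltnP n r.
  rewrite lag_lt // big1_seq // => a _; rewrite /delta ltn_eqF ?mulr0 //.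
  by apply: leq_trans ltnr _; apply: leq_addr.
rewrite lag_sub // -(@sum_iota_pick _ B (n - r)); last exact: leq_ltn_trans (leq_subr _ _) nB.
apply: eq_bigr => a _; rewrite /delta -(eqn_add2l r) subnKC // eq_sym.
by case: eqP; rewrite ?mulr1 ?mulr0.
Qed.

Lemma convolution_lag_sum (f g : nat -> F) n B : (n < B)%N ->
  convolution f g n = \sum_(i <- iota 0 B) g i * lag i f n.
Proof.
move=> nB; rewrite convolutionC /convolution -(big_mkord xpredT (fun i => g i * f (n - i)%N)).
rewrite -[in RHS](subnKC nB) iotaD big_cat /= [X in _ + X]big1_seq ?addr0 => [|i].
  rewrite /index_iota subn0; apply: eq_big_seq => i; rewrite mem_iota ltnS => /andP[_ lin].
  by rewrite lag_sub.
by rewrite mem_iota add0n => /andP[_ /andP[lt _]]; rewrite lag_lt ?mulr0.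
Qed.

(** Multiplication by the factors summed over i, j, k, the sum being cut at B. *)
Definition outer (B : nat) (g : nat -> F) (N : nat) : F :=
  \sum_(i <- iota 0 B) \sum_(j <- iota 0 B) \sum_(k <- iota 0 B)
    odd_parts_gf q i * (q ^+ (4 * j) / qfact (q ^+ 4) j) * lag (k + (2 * j + i)) g N.

Lemma double_gf_sum B (f : nat -> F) n : (n < B)%N ->
  \sum_(b <- iota 0 B) double_gf q b * lag b f n =
  \sum_(j <- iota 0 B) q ^+ (4 * j) / qfact (q ^+ 4) j * lag (2 * j) f n.
Proof.
move=> nB.
have E b : (n < b)%N -> double_gf q b * lag b f n = 0 by move=> ltnb; rewrite lag_lt ?mulr0.
transitivity (\sum_(b <- iota 0 B) \sum_(j <- iota 0 B)
    if (b == 2 * j)%N then double_gf q b * lag b f n else 0).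
  apply: eq_big_seq => b; rewrite mem_iota add0n => /andP[_ bB].
  have [ob|eb] := boolP (odd b).
    rewrite {1}/double_gf ob mul0r big1 // => j _.
    by rewrite /double_gf ob mul0r if_same.
  have Eb : b = (2 * b./2)%N by clear -eb; lia.
  transitivity (\sum_(j <- iota 0 B) if j == b./2 then double_gf q b * lag b f n else 0).
    by rewrite (sum_iota_pick (fun _ => _)) //; clear -bB; lia.
  apply: eq_bigr => j _; congr (if _ then _ else _); clear -eb; lia.
rewrite exchange_big; apply: eq_bigr => j _ /=.
have [ltnj|lejn] := ltnP n (2 * j).
  rewrite (lag_lt _ ltnj) mulr0 big1 // => b _.
  by case: eqP => // ->; rewrite E.
rewrite (sum_iota_pick (fun b => double_gf q b * lag b f n)); last exact: leq_ltn_trans lejn nB.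
by rewrite /double_gf mul2n odd_double doubleK.
Qed.

Lemma unstaired_gf_outer B N : (N < B)%N ->
  unstaired_gf q N = outer B (twice_gf (q ^+ 2)) N.
Proof.
move=> NB; rewrite /unstaired_gf -(big_mkord xpredT (nonzero_gf q)).
transitivity (\sum_(k <- iota 0 B) lag k (nonzero_gf q) N).
  transitivity (convolution (nonzero_gf q) (fun=> 1) N).
    by rewrite big_mkord; apply: eq_bigr => k _; rewrite mulr1.
  by rewrite (convolution_lag_sum _ _ NB); apply: eq_bigr => k _; rewrite mul1r.
have Es n : (n <= N)%N -> nonzero_gf q n = \sum_(j <- iota 0 B) \sum_(i <- iota 0 B)
    odd_parts_gf q i * (q ^+ (4 * j) / qfact (q ^+ 4) j) * lag (2 * j + i) (twice_gf (q ^+ 2)) n.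
  move=> leN; have nB := leq_ltn_trans leN NB.
  rewrite /nonzero_gf (convolution_lag_sum _ _ nB) double_gf_sum //; apply: eq_bigr => j _.
  rewrite (lag_eq (g := fun n => \sum_(i <- iota 0 B) odd_parts_gf q i * lag i (twice_gf (q ^+ 2)) n)).
    rewrite lag_sum mulr_sumr; apply: eq_bigr => i _.
    by rewrite lagM lag_lag mulrCA !mulrA.
  by move=> m lem; apply: convolution_lag_sum; apply: leq_ltn_trans lem nB.
transitivity (\sum_(k <- iota 0 B) \sum_(j <- iota 0 B) \sum_(i <- iota 0 B)
    odd_parts_gf q i * (q ^+ (4 * j) / qfact (q ^+ 4) j) * lag (k + (2 * j + i)) (twice_gf (q ^+ 2)) N).
  apply: eq_bigr => k _; rewrite (lag_eq k Es) lag_sum; apply: eq_bigr => j _.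
  by rewrite lag_sum; apply: eq_bigr => i _; rewrite lagM lag_lag.
rewrite exchange_big /= [RHS]exchange_big /=; apply: eq_bigr => j _.
exact: exchange_big.
Qed.

Lemma eq_outer B (g g' : nat -> F) N :
  (forall n, (n <= N)%N -> g n = g' n) -> outer B g N = outer B g' N.
Proof.
by move=> gg'; do 3!(apply: eq_bigr => ? _); congr (_ * _); apply: lag_eq.
Qed.

Lemma outer_sum B (I : Type) (l : seq I) (c : I -> F) (g : I -> nat -> F) N :
  outer B (fun n => \sum_(x <- l) c x * g x n) N = \sum_(x <- l) c x * outer B (g x) N.
Proof.
rewrite /outer.
under [RHS]eq_bigr => x _.
  rewrite mulr_sumr; under eq_bigr => i _.
    rewrite mulr_sumr; under eq_bigr => j _ do rewrite mulr_sumr.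
    over.
  over.
rewrite [RHS]exchange_big /=; apply: eq_bigr => i _.
rewrite [RHS]exchange_big /=; apply: eq_bigr => j _.
rewrite [RHS]exchange_big /=; apply: eq_bigr => k _.
rewrite lag_sum mulr_sumr; apply: eq_bigr => x _.
by rewrite lagM mulrCA.
Qed.

(** What the summands contribute beyond P, for p pairs, c blocks and largest pair [f,f] or
[f,f+1]; it depends on m1 and m2 only through p, which is what makes it possible to sum
over walks instead of over m1, m2, m3. *)
Definition box_term (B N p c f : nat) : F :=
  \sum_(n12 <- iota 0 B) \sum_(i <- iota 0 B) \sum_(j <- iota 0 B) \sum_(k <- iota 0 B)
    if N == (2 * p + c + n12 + i + 2 * j + k)%N then
      q ^+ (2 * f * n12 + 2 * n12 ^ 2 + i + 4 * j + N ^ 2)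
      / (qfact (q ^+ 2) n12 * qfact (q ^+ 6) p * qfact (q ^+ 2) i * qfact (q ^+ 4) j)
    else 0.

Lemma outer_walk_term B N p c t : (forall n, 1 - q ^+ n.+1 != 0) -> (N < B)%N ->
  q ^+ (N ^ 2) * ((qfact ((q ^+ 2) ^+ 3) p)^-1 *
     outer B (lag (2 * p + c) (singletons_gf (q ^+ 2) t)) N) = box_term B N p c t./2.
Proof.
move=> q1 NB; rewrite (@eq_outer B _ (fun n => \sum_(a <- iota 0 B)
    singletons_gf (q ^+ 2) t a * delta (2 * p + c + a) n) N); last first.
  by move=> n leN; apply: lag_delta_sum; apply: leq_ltn_trans leN NB.
rewrite outer_sum !mulr_sumr; apply: eq_bigr => n12 _; rewrite /outer.
rewrite !mulr_sumr; apply: eq_bigr => i _; rewrite !mulr_sumr; apply: eq_bigr => j _.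
rewrite !mulr_sumr; apply: eq_bigr => k _; rewrite lag_delta.
have -> : (k + (2 * j + i) + (2 * p + c + n12) = 2 * p + c + n12 + i + 2 * j + k)%N by lia.
case: ifP => _; last by rewrite !mulr0.
rewrite /singletons_gf /odd_parts_gf -!exprM mulr1.
have -> : (2 * t./2 * n12 + 2 * n12 ^ 2 + i + 4 * j + N ^ 2 =
   N ^ 2 + (2 * (t./2 * n12 + n12 ^ 2) + (i + 4 * j)))%N by lia.
have n1 := qfact_neq0 q1 1 n12; have n2 := qfact_neq0 q1 5 p.
have n3 := qfact_neq0 q1 1 i; have n4 := qfact_neq0 q1 3 j.
move: (2 * (_ + _))%N (4 * j)%N => e1 e2.
by rewrite !exprD; field; rewrite n1 n2 n3 n4.
Qed.

Lemma kr1_gf_walks B N : (forall n, 1 - q ^+ n.+1 != 0) -> (N < B)%N ->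
  kr1_gf q N = \sum_(p <- iota 0 N.+1) \sum_(w <- walks p 0)
    (q ^+ 2) ^+ sumn (walk_parts w) * box_term B N p (count_mem 5%N w) (sumn w)./2.
Proof.
move=> q1 NB; rewrite /kr1_gf (unstaired_gf_outer NB).
rewrite (@eq_outer B _ (fun n => \sum_(p <- iota 0 N.+1) 1 * even_gf (q ^+ 2) p n) N); last first.
  move=> n leN; rewrite /twice_gf -(sum_gf_widen (B := N.+1)).
  - by rewrite -(big_mkord xpredT (fun p => even_gf _ p n)); apply: eq_bigr => p _; rewrite mul1r.
  - by move=> p m /(gf_small (q ^+ 2))[].
  - by clear -leN; lia.
rewrite outer_sum mulr_sumr; apply: eq_bigr => p _; rewrite mul1r.
rewrite (@eq_outer B _ (fun n => \sum_(w <- walks p 0)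
    ((qfact ((q ^+ 2) ^+ 3) p)^-1 * (q ^+ 2) ^+ sumn (walk_parts w)) *
    lag (2 * size w + count_mem 5%N w) (singletons_gf (q ^+ 2) (sumn w)) n) N); last first.
  move=> n _; rewrite /even_gf walk_gf_sum mulr_sumr; apply: eq_bigr => w _.
  by rewrite add0n mulrA.
rewrite outer_sum mulr_sumr; apply: eq_big_seq => w; rewrite mem_walks => /andP[/eqP-> _].
rewrite -(outer_walk_term p _ _ q1 NB) [_^-1 * _ in LHS]mulrC -mulrA.
exact: mulrCA.
Qed.
End BoxSum.

Lemma box_term_large (F : fieldType) (q : F) B N p c f : (N < p)%N -> box_term q B N p c f = 0.
Proof.
move=> ltNp; rewrite /box_term big1 // => n12 _; rewrite big1 // => i _.
rewrite big1 // => j _; rewrite big1 // => k _.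
by rewrite ifF //; clear -ltNp; lia.
Qed.

Lemma sumn_walk_le t w : is_walk t w -> (sumn w <= 5 * size w)%N.
Proof.
elim: w t => //= d w IHw t /andP[]; rewrite mem_steps => dt /IHw le.
by clear -dt le; lia.
Qed.

Lemma walk_stats_size m1 m2 m3 m w : is_walk 0 w -> walk_stats m1 m2 m3 m w ->
  size w = (m1 + m2 + 2 * m3)%N.
Proof.
move=> wP /and4P[/eqP b1 /eqP b2 /eqP b3 _].
by rewrite -free_countE b1 b2 block_count_walk // b3.
Qed.

Lemma walk_stats_bound m1 m2 m3 m w : is_walk 0 w -> walk_stats m1 m2 m3 m w ->
  [/\ m1 <= 5 * size w, m2 <= 5 * size w, m3 <= 5 * size w & m <= 5 * size w]%N.
Proof.
move=> wP st; have sz := walk_stats_size wP st; have le := sumn_walk_le wP.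
by case/and4P: st => _ _ _ /eqP Em; clear -Em sz le; split; lia.
Qed.

(** Each walk has exactly one vector of statistics; the cut-off B has to exceed them all,
and the sum of p steps, hence m, is at most 5p. *)
Lemma sum_walk_stats (R : pzSemiRingType) (B N : nat) (f : seq nat -> R) (g : nat -> nat -> nat -> R) :
    (5 * N < B)%N -> (forall p c m, (N < p)%N -> g p c m = 0) ->
  \sum_(m1 <- iota 0 B) \sum_(m2 <- iota 0 B) \sum_(m3 <- iota 0 B) \sum_(m <- iota 0 B)
    (\sum_(w <- walks (m1 + m2 + 2 * m3) 0 | walk_stats m1 m2 m3 m w) f w)
       * g (m1 + m2 + 2 * m3)%N m3 m =
  \sum_(p <- iota 0 N.+1) \sum_(w <- walks p 0) f w * g p (count_mem 5%N w) (sumn w)./2.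
Proof.
move=> NB g0.
pose L := [seq (p, w) | p <- iota 0 N.+1, w <- walks p 0].
have LP x : x \in L -> [/\ x.1 = size x.2, is_walk 0 x.2 & (size x.2 <= N)%N].
  case/allpairsPdep=> p [w [pN]]; rewrite mem_walks => /andP[/eqP szw wP] -> /=.
  by rewrite szw; move: pN; rewrite mem_iota ltnS => /andP[].
pose v x := f x.2 * g x.1 (count_mem 5%N x.2) (sumn x.2)./2.
transitivity (\sum_(x <- L) v x); last by rewrite big_allpairs_dep.
transitivity (\sum_(m1 <- iota 0 B) \sum_(m2 <- iota 0 B) \sum_(m3 <- iota 0 B)
   \sum_(m <- iota 0 B) \sum_(x <- L) if walk_stats m1 m2 m3 m x.2 then v x else 0).
  apply: eq_bigr => m1 _; apply: eq_bigr => m2 _; apply: eq_bigr => m3 _.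
  apply: eq_bigr => m _; rewrite /L big_allpairs_dep; set p0 := (m1 + m2 + 2 * m3)%N.
  have st_size p w : w \in walks p 0 -> walk_stats m1 m2 m3 m w -> p == p0.
    by rewrite mem_walks => /andP[/eqP <- wP] /(walk_stats_size wP) ->.
  transitivity (\sum_(p <- iota 0 N.+1) if p == p0
      then \sum_(w <- walks p 0 | walk_stats m1 m2 m3 m w) v (p, w) else 0).
    have [lep|ltp] := leqP p0 N; last first.
      rewrite g0 // mulr0 big1_seq // => p; rewrite mem_iota ltnS => /andP[_ /andP[_ lepN]].
      by rewrite ltn_eqF // (leq_ltn_trans lepN).
    rewrite sum_iota_pick // mulr_suml; apply: eq_bigr => w /and4P[_ _ /eqP E3 /eqP Em].
    by rewrite /v /= E3 Em.
  apply: eq_bigr => p _; rewrite -big_mkcond; case: eqP => [//|/eqP np].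
  rewrite big_seq_cond big_pred0 // => w; apply/negP => /andP[wp /(st_size _ _ wp)].
  by rewrite (negPf np).
under eq_bigr => m1 _.
  under eq_bigr => m2 _.
    under eq_bigr => m3 _ do rewrite exchange_big.
    rewrite exchange_big; over.
  rewrite exchange_big; over.
rewrite exchange_big; apply: eq_big_seq => x /LP[E1 wP szN] /=.
set a1 := free_repeating_count (walk_groups 0 x.2).
set a2 := free_successive_count (walk_groups 0 x.2).
set a3 := count_mem 5%N x.2; set a4 := (sumn x.2)./2.
have st : walk_stats a1 a2 a3 a4 x.2 by rewrite /walk_stats !eqxx.
have bd a : (a <= 5 * size x.2)%N -> (a < B)%N by clear -szN NB; lia.
have [/bd b1 /bd b2 /bd b3 /bd b4] := walk_stats_bound wP st.
transitivity (\sum_(m1 <- iota 0 B) if m1 == a1 then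
    \sum_(m2 <- iota 0 B) if m2 == a2 then
    \sum_(m3 <- iota 0 B) if m3 == a3 then
    \sum_(m <- iota 0 B) (if m == a4 then v x else 0) else 0 else 0 else 0).
  apply: eq_bigr => m1 _; rewrite /walk_stats -/a1 -/a2 -/a3 -/a4 [m1 == _]eq_sym.
  case: (a1 == m1); last by do 3!(rewrite big1 // => ? _).
  apply: eq_bigr => m2 _; rewrite [m2 == _]eq_sym.
  case: (a2 == m2); last by do 2!(rewrite big1 // => ? _).
  apply: eq_bigr => m3 _; rewrite [m3 == _]eq_sym.
  case: (a3 == m3); last by rewrite big1.
  by apply: eq_bigr => m _; rewrite [m == _]eq_sym.
by rewrite (sum_iota_pick (fun _ => _)) // (sum_iota_pick (fun _ => _)) //
  (sum_iota_pick (fun _ => _)) // (sum_iota_pick (fun _ => _)).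
Qed.

(** * Fractions represented by power series *)

Lemma convolution_coefM (R : nzRingType) (f g : nat -> R) m n : (n <= m)%N ->
  convolution f g n = ((\poly_(i < m.+1) f i) * (\poly_(i < m.+1) g i))`_n.
Proof.
move=> lenm; rewrite coefM; apply: eq_bigr => i _; rewrite !coef_poly !ltnS.
by rewrite (leq_trans (leq_ord i) lenm) (leq_trans (leq_subr _ _) lenm).
Qed.

Lemma convolutionA (R : nzRingType) (f g h : nat -> R) n :
  convolution (convolution f g) h n = convolution f (convolution g h) n.
Proof.
pose T (f : nat -> R) := \poly_(i < n.+1) f i.
transitivity ((T f * T g * T h)`_n).
  rewrite coefM; apply: eq_bigr => i _.
  rewrite (convolution_coefM _ _ (leq_ord i)).
  by rewrite /T !coef_poly !ltnS leq_subr.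
rewrite -mulrA [LHS]coefM; apply: eq_bigr => i _.
rewrite (convolution_coefM g h (leq_subr i n)).
by rewrite {1}/T coef_poly ltn_ord.
Qed.

Lemma convolution_Xn (R : nzRingType) e (s : nat -> R) n :
  convolution (fun i => 'X^e`_i) s n = lag e s n.
Proof.
rewrite /convolution.
under eq_bigr => i _ do rewrite coefXn.
have [ltne|lene] := ltnP n e.
  rewrite lag_lt // big1 // => i _.
  by rewrite ltn_eqF ?mul0r //; apply: leq_ltn_trans (leq_ord i) _.
rewrite lag_sub // (bigD1 (Ordinal (n := n.+1) (m := e) lene)) //= eqxx mul1r.
rewrite big1 ?addr0 // => i; rewrite -val_eqE /= => /negPf->.
by rewrite mul0r.
Qed.

Local Notation QF := {fraction {poly int}}.
Local Notation "x %:F" := (@tofrac _ x).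

Lemma tofrac_neq0 (d : {poly int}) : d`_0 = 1 -> d%:F != 0 :> QF.
Proof. by move=> d0; rewrite tofrac_eq0; apply: contra_eq_neq d0 => ->; rewrite coef0. Qed.

(** The expansion of r at q = 0, stated by clearing a denominator with constant coefficient 1
instead of by inverting it. *)
Definition represents (s : nat -> int) (r : QF) : Prop :=
  exists d p : {poly int}, [/\ d`_0 = 1,
    forall n, convolution (fun i => d`_i) s n = p`_n & r * d%:F = p%:F].

(** With the common denominator d d', invertible as a power series, s and s' are determined
by the same numerator. *)
Lemma represents_inj s s' r : represents s r -> represents s' r -> s =1 s'.
Proof.
move=> [d [p [d0 ds rd]]] [d' [p' [d'0 ds' rd']]].
have pd : p * d' = p' * d.
  by apply/eqP; rewrite -tofrac_eq !rmorphM /= -rd -rd' mulrAC.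
have E n : convolution (fun i => (d * d')`_i) s n = convolution (fun i => (d * d')`_i) s' n.
  have coefE (a b : {poly int}) t m : convolution (fun i => (a * b)`_i) t m =
      convolution (fun i => a`_i) (convolution (fun i => b`_i) t) m.
    rewrite -convolutionA; apply: eq_convolution => // i.
    by rewrite /convolution coefM.
  rewrite {1}mulrC !coefE.
  transitivity ((p * d')`_n); last first.
    by rewrite pd mulrC coefM; apply: eq_bigr => i _; rewrite ds'.
  by rewrite mulrC coefM; apply: eq_bigr => i _; rewrite ds.
have D0 : (d * d')`_0 = 1 by rewrite coefM big_ord1 d0 d'0.
elim/ltn_ind=> n IHn; have := E n.
rewrite /convolution !big_ord_recl /= D0 !mul1r !subn0.
rewrite [X in _ + X = _ -> _](eq_bigr (fun i : 'I_n => (d * d')`_(bump 0 i) * s' (n - bump 0 i)%N)).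
  exact: addIr.
move=> i _; rewrite IHn //; rewrite /bump /=; case: i => i /= lti; lia.
Qed.

Lemma eq_represents s s' r : s =1 s' -> represents s r -> represents s' r.
Proof.
move=> ss' [d [p [d0 ds rd]]]; exists d, p; split=> // n.
by rewrite -ds; apply: eq_convolution.
Qed.

Lemma represents_mul (p : {poly int}) s r :
  represents s r -> represents (convolution (fun i => p`_i) s) (p%:F * r).
Proof.
move=> [d [p' [d0 ds rd]]]; exists d, (p * p'); split=> // [n|].
  rewrite coefM -convolutionA.
  transitivity (convolution (convolution (fun i => p`_i) (fun i => d`_i)) s n).
    by apply: eq_convolution => // i; apply: convolutionC.
  by rewrite convolutionA; apply: eq_bigr => i _; rewrite ds.
by rewrite -mulrA rd rmorphM.
Qed.

Lemma represents_lag e s r :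
  represents s r -> represents (lag e s) ('X%:F ^+ e * r).
Proof.
move=> sr; rewrite -rmorphXn /=.
by apply: eq_represents (represents_mul 'X^e sr) => n; apply: convolution_Xn.
Qed.

Lemma represents_div (e : {poly int}) s r : e`_0 = 1 ->
  represents (convolution (fun i => e`_i) s) r -> represents s (r / e%:F).
Proof.
move=> e0 [d [p [d0 ds rd]]]; exists (d * e), p; split.
- by rewrite coefM big_ord1 d0 e0.
- move=> n; rewrite -ds -convolutionA; apply: eq_convolution => // i.
  by rewrite coefM.
- by rewrite rmorphM /= mulrACA [_^-1 * _]mulrC mulrA mulfK ?tofrac_neq0 // rd.
Qed.

Lemma represents_poly (p : {poly int}) : represents (fun i => p`_i) p%:F.
Proof.
exists 1, p; split; rewrite ?coef1 ?mulr1 // => n.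
rewrite /convolution big_ord_recl coef1 mul1r subn0 big1 ?addr0 // => i _.
by rewrite coef1 mul0r.
Qed.

Lemma represents_ps_div (p d : {poly int}) :
  d`_0 = 1 -> represents (ps_div p d) (p%:F / d%:F).
Proof.
move=> d0; exists d, p; split=> // [n|]; first exact: ps_divP.
by rewrite mulfVK // tofrac_neq0.
Qed.

Lemma representsD s s' r r' : represents s r -> represents s' r' ->
  represents (fun n => s n + s' n) (r + r').
Proof.
move=> [d [p [d0 ds rd]]] [d' [p' [d'0 ds' rd']]].
rewrite [r + r'](_ : _ = (p * d' + p' * d)%:F / (d' * d)%:F); last first.
  have nz := tofrac_neq0 d0; have nz' := tofrac_neq0 d'0.
  rewrite tofracD !tofracM -rd -rd' [r * _ * _]mulrAC -!mulrDl -[_ * _ * d%:F]mulrA.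
  by rewrite (mulfK (mulf_neq0 nz' nz)).
apply: represents_div; first by rewrite coefM big_ord1 d0 d'0.
apply: eq_represents (represents_poly _) => n; rewrite coefD convolutionDr.
have coefE (a b : {poly int}) t m : convolution (fun i => (a * b)`_i) t m =
    convolution (fun i => a`_i) (convolution (fun i => b`_i) t) m.
  by rewrite -convolutionA; apply: eq_convolution => // i; rewrite /convolution coefM.
congr (_ + _); last rewrite [d' * _]mulrC; rewrite coefE mulrC coefM.
  by apply: eq_bigr => i _; rewrite ds.
by apply: eq_bigr => i _; rewrite ds'.
Qed.

Lemma represents_sum (I : Type) (l : seq I) (s : I -> nat -> int) (r : I -> QF) :
  (forall i, represents (s i) (r i)) ->
  represents (fun n => \sum_(i <- l) s i n) (\sum_(i <- l) r i).
Proof.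
move=> sr; elim: l => [|i l IHl].
  rewrite big_nil; apply: eq_represents (represents_poly 0) => n.
  by rewrite big_nil coef0.
rewrite big_cons; apply: eq_represents (representsD (sr i) IHl) => n.
by rewrite big_cons.
Qed.

(** * Counting the partitions of the left-hand side *)

Local Open Scope nat_scope.

(** The conditions invariant under the addition of an even number to all parts; positivity
and the absence of 2+2 are not. *)
Definition spaced (l : seq nat) : bool :=
  [&& sorted leq l, no_consecutive_parts l, odd_parts_distinct l
    & gap_around_repeated_even l].

Lemma spaced_shift k l : ~~ odd k -> spaced (map (addn k) l) = spaced l.
Proof.
move=> ok; have cntk x : count_mem (k + x) (map (addn k) l) = count_mem x l.
  by rewrite count_map; apply: eq_count => y /=; rewrite eqn_add2l.
rewrite /spaced; congr [&& _, _, _ & _].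
- by rewrite sorted_map; apply: eq_sorted => x y /=; rewrite leq_add2l.
- rewrite /no_consecutive_parts all_map; apply: eq_all => x /=.
  by rewrite -addnS mem_map //; apply: addnI.
- rewrite /odd_parts_distinct all_map; apply: eq_all => x /=.
  by rewrite cntk oddD (negPf ok).
rewrite /gap_around_repeated_even size_map; apply: eq_in_all => i.
rewrite mem_iota add0n => /andP[_ lti].
rewrite !(nth_map 0); try lia.
rewrite cntk oddD (negPf ok) /=; congr (_ ==> _); lia.
Qed.

Lemma sorted_count_head b c l : sorted leq [:: b, c & l] ->
  (1 < count_mem b [:: b, c & l]) = (b == c).
Proof.
rewrite /= (path_sortedE leq_trans) => /and3P[lebc /allP cl _].
rewrite eqxx [c == b]eq_sym; case: eqP => //= nbc.
suff -> : count_mem b l = 0 by [].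
by apply/count_memPn/negP => /cl; lia.
Qed.

(** Below parts that are at least x + 2, a new smallest part x matters only to a repeated
even part that comes right after it. *)
Lemma spaced_cons x l : all (leq x.+2) l ->
  spaced (x :: l) = spaced l &&
    (if l is b :: c :: _ then ~~ odd b && (b == c) ==> (x + 4 <= b) else true).
Proof.
move=> /allP xl; have xNl y : y \in l -> (x == y) = false by move/xl; lia.
have sE : sorted leq (x :: l) = sorted leq l.
  rewrite /= (path_sortedE leq_trans); case: allP => //= H.
  by case: H => y /xl; lia.
rewrite /spaced sE; case: (boolP (sorted leq l)) => //= sl.
have -> : no_consecutive_parts (x :: l) = no_consecutive_parts l.
  rewrite /no_consecutive_parts /= inE.
  rewrite (_ : x.+1 \in l = false) ?orbF; last by apply/negP=> /xl; lia.
  rewrite (_ : x.+1 == x = false) /=; last lia.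
  apply: eq_in_all => y yl; rewrite inE; have := xl _ yl => ley.
  by rewrite (_ : (y.+1 == x) = false) //; lia.
have -> : odd_parts_distinct (x :: l) = odd_parts_distinct l.
  rewrite /odd_parts_distinct /= eqxx (_ : count_mem x l = 0).
    rewrite implybT /=; apply: eq_in_all => y yl.
    by rewrite (xNl _ yl).
  by apply/count_memPn/negP => /xNl; rewrite eqxx.
case: (no_consecutive_parts l) => //=; case: (odd_parts_distinct l) => //=.
case: l xl xNl sl {sE} => [|b [|c l]] xl xNl sl //.
rewrite {1}/gap_around_repeated_even [size _]/= !subSS subn0.
rewrite -[iota 0 _]/(0 :: iota 1 (size l)) [LHS]/= andbC; congr (_ && _).
  rewrite (iotaDl 1 0) all_map /gap_around_repeated_even [size _]/= !subSS subn0.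
  apply: eq_in_all => i; rewrite mem_iota add0n => /andP[_ lti].
  have yl : nth 0 (c :: l) i \in [:: b, c & l].
    by rewrite inE mem_nth ?orbT // ltnS ltnW.
  by rewrite /= xNl.
rewrite (xNl b) ?mem_head // add0n; have := sorted_count_head sl => /= ->.
case: (b =P c) => [<-|_]; last by rewrite !andbF.
congr (_ ==> _).
have := xl b (mem_head _ _); lia.
Qed.

Lemma spaced_cons2 x l : ~~ odd x -> all (leq (x + 4)) l ->
  spaced [:: x, x & l] = spaced l.
Proof.
move=> ox /allP xl; have xNl y : y \in l -> (x == y) = false by move/xl; lia.
have sE : sorted leq [:: x, x & l] = sorted leq l.
  rewrite /= leqnn (path_sortedE leq_trans); case: allP => //= H.
  by case: H => y /xl; lia.
rewrite /spaced sE; case: (boolP (sorted leq l)) => //= sl.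
have -> : no_consecutive_parts [:: x, x & l] = no_consecutive_parts l.
  rewrite /no_consecutive_parts /= !inE.
  rewrite (_ : x.+1 \in l = false) ?orbF; last by apply/negP=> /xl; lia.
  rewrite (_ : x.+1 == x = false) /=; last lia.
  apply: eq_in_all => y yl; rewrite !inE; have := xl _ yl => ley.
  by rewrite (_ : (y.+1 == x) = false) //; lia.
have -> : odd_parts_distinct [:: x, x & l] = odd_parts_distinct l.
  rewrite /odd_parts_distinct /= (negPf ox) /=; apply: eq_in_all => y yl.
  by rewrite (xNl _ yl).
congr [&& _, _ & _].
case: l xl xNl sl {sE} => [|b l] xl xNl sl //.
rewrite {1}/gap_around_repeated_even [size _]/= !subSS subn0.
rewrite -[iota 0 _]/(0 :: iota 1 (size l)) [LHS]/=.
rewrite (_ : (4 <= _) = true) ?implybT /=; last by have := xl b (mem_head _ _); lia.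
rewrite (iotaDl 1 0) all_map.
case: l xl xNl sl => [|c l] xl xNl sl //.
rewrite -[iota 0 _]/(0 :: iota 1 (size l)) [LHS]/=.
rewrite (_ : (4 <= _) = true) ?implybT /=; last first.
  by have := xl c; rewrite !inE eqxx orbT => /(_ isT); lia.
rewrite (iotaDl 1 0) all_map /gap_around_repeated_even [size _]/= !subSS subn0.
apply: eq_in_all => i; rewrite mem_iota add0n => /andP[_ lti].
have yl : nth 0 (c :: l) i \in [:: b, c & l].
  by rewrite inE mem_nth ?orbT // ltnS ltnW.
by rewrite /= (xNl _ yl).
Qed.

Lemma shift_up k l : all (leq k) l -> map (addn k) (map (subn^~ k) l) = l.
Proof. by elim: l => //= x l IHl /andP[kx /IHl->]; rewrite subnKC. Qed.

Definition any_spaced (l : seq nat) : bool := spaced l && (0 \notin l).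
Definition spaced_no1 (l : seq nat) : bool := any_spaced l && (1 \notin l).
Definition spaced_no22 (l : seq nat) : bool := any_spaced l && no_two_plus_two l.
Definition spaced_no1_no22 (l : seq nat) : bool := spaced_no22 l && (1 \notin l).

Lemma kr1_partitionE l : kr1_partition l = spaced_no22 l.
Proof.
rewrite /kr1_partition /spaced_no22 /any_spaced /spaced /is_partition.
move: (sorted _ _) (0 \notin l) (no_consecutive_parts l) (odd_parts_distinct l).
by move: (gap_around_repeated_even l) (no_two_plus_two l) => [] [] [] [] [] [].
Qed.

Lemma sorted_min_head x l :
  sorted leq l -> x \in l -> all (leq x) l -> exists2 l1, l = x :: l1 & all (leq x) l1.
Proof.
case: l => // y l; rewrite /= (path_sortedE leq_trans) => /andP[/allP yl _].
move=> xl /andP[lexy xl1]; exists l => //; congr (_ :: _); apply/eqP.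
rewrite eqn_leq lexy andbT; move: xl; rewrite inE => /orP[/eqP->//|/yl//].
Qed.

Lemma any_spaced_ge1 l : any_spaced l -> all (leq 1) l.
Proof.
by case/andP=> _ l0; apply/allP=> -[|//] xl; rewrite xl in l0.
Qed.

Lemma spaced_nextN x l : spaced l -> x \in l -> x.+1 \notin l.
Proof. by case/and4P=> _ /allP + _ _ => /[apply]. Qed.

Lemma head1_rest l : any_spaced l -> 1 \in l -> exists2 l1, l = 1 :: l1 & all (leq 3) l1.
Proof.
move=> vl l1; have [sl _] := andP vl; have [sortl _ odl _] := and4P sl.
have := spaced_nextN sl l1; have [l' El] := sorted_min_head sortl l1 (any_spaced_ge1 vl).
move/allP: odl => /(_ 1 l1); rewrite {}El !inE /=. rewrite add1n ltnS leqn0 => /eqP.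
move/count_memPn=> N1 ge1 N2; exists l' => //; apply/allP=> y yl.
have := allP ge1 y yl; case: y yl => [|[|[|y]]] //; first by rewrite (negPf N1).
by rewrite (negPf N2).
Qed.

Lemma head2_rest l : spaced_no1_no22 l -> 2 \in l ->
  exists2 l1, l = 2 :: l1 & all (leq 4) l1.
Proof.
case/andP=> /andP[vl n22] N1 l2; have [sl _] := andP vl.
have [sortl _ _ _] := and4P sl; have := spaced_nextN sl l2.
have ge2 : all (leq 2) l.
  apply/allP=> -[|[|y]] // yl; last by rewrite yl in N1.
  by have := allP (any_spaced_ge1 vl) _ yl.
have [l' El ge2'] := sorted_min_head sortl l2 ge2.
move: n22; rewrite /no_two_plus_two El !inE /= add1n ltnS ltnS leqn0 => /eqP.
move/count_memPn=> N2 N3; exists l' => //; apply/allP=> y yl.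
have := allP ge2' y yl; case: y yl => [|[|[|[|y]]]] //; first by rewrite (negPf N2).
by rewrite (negPf N3).
Qed.

Lemma gap4_after2 (b : nat) : 2 <= b -> 4 <= `|(2%Z - b%:Z)%R|%N -> 6 <= b.
Proof. lia. Qed.

Lemma head22_rest l : any_spaced l -> ~~ no_two_plus_two l ->
  exists2 l2, l = [:: 2, 2 & l2] & all (leq 6) l2.
Proof.
move=> vl n22; have [sl _] := andP vl; have [sortl cl _ gl] := and4P sl.
have l2 : 2 \in l.
  by apply: contraNT n22 => /count_memPn; rewrite /no_two_plus_two => ->.
have N1 : 1 \notin l by apply: contraL l2 => l1; exact: spaced_nextN sl l1.
have N3 := spaced_nextN sl l2.
have ge2 : all (leq 2) l.
  apply/allP=> -[|[|y]] // yl; last by rewrite yl in N1.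
  by have := allP (any_spaced_ge1 vl) _ yl.
have [l' El ge2'] := sorted_min_head sortl l2 ge2.
have sortl' : sorted leq l' by move: sortl; rewrite El /= (path_sortedE leq_trans) => /andP[].
have l'2 : 2 \in l'.
  apply: contraNT n22 => /count_memPn c0.
  by rewrite /no_two_plus_two El /= c0.
have [l'' El' _] := sorted_min_head sortl' l'2 ge2'.
exists l''; first by rewrite El El'.
case: l'' El' => // b m El'; move: gl.
rewrite El El' /gap_around_repeated_even [size _]/= !subSS subn0 /= => /andP[].
rewrite -[4 <= _]/(4 <= `|2%Z - b%:Z|%N)%N.
have leb : 2 <= b by apply: (allP ge2'); rewrite El' !inE eqxx orbT.
move=> gb _; have {gb} ge6 : 6 <= b by apply: gap4_after2.
have : sorted leq (b :: m) by move: sortl'; rewrite El' /= => /andP[].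
rewrite /= (path_sortedE leq_trans) ge6 => /andP[/allP bm _].
by apply/allP=> y /bm; apply: leq_trans.
Qed.

(** After the part 1 one may not have 4+4, which is 2+2 before the shift. *)
Lemma cons1_shift s : spaced_no22 (1 :: map (addn 2) s) = spaced_no22 s.
Proof.
have [s0|s0] := boolP (0 \in s).
  rewrite [RHS]/spaced_no22 /any_spaced s0 andbF /=.
  apply/negP=> /andP[/andP[sp _] _].
  have := spaced_nextN sp (mem_head _ _).
  by rewrite inE (mem_map (@addnI 2) s 0) s0 orbT.
have ge3 : all (leq 3) (map (addn 2) s).
  by rewrite all_map; apply/allP => -[|y] //= ys; rewrite ys in s0.
rewrite /spaced_no22 /any_spaced spaced_cons // spaced_shift // s0 andbT.
have -> : 0 \notin 1 :: map (addn 2) s by rewrite inE /=; apply/mapP=> -[].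
rewrite andbT -andbA; case: (boolP (spaced s)) => //= sp.
have -> : no_two_plus_two (1 :: map (addn 2) s).
  rewrite /no_two_plus_two /= add0n count_map (_ : count _ _ = 0) //.
  by apply/count_memPn.
rewrite andbT; case: s s0 sp {ge3} => [|b [|c s]] s0 sp //=.
  by rewrite /no_two_plus_two /= addn0; case: eqP.
rewrite eqn_add2l oddD /=.
have [sl _ _ _] := and4P sp; have lebc : b <= c by case/andP: sl.
have cs : all (leq c) s.
  by move: sl; rewrite /= (path_sortedE leq_trans) => /and3P[].
have b0 : b != 0 by apply: contra s0 => /eqP->; rewrite mem_head.
case: (eqVneq b 2) => [b2|nb2].
  rewrite /no_two_plus_two b2 /= in sp *.
  rewrite [2 == c]eq_sym; case: eqP => //= nc.
  rewrite add0n (_ : count _ _ = 0) //; apply/count_memPn/negP => /(allP cs).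
  by lia.
have -> : no_two_plus_two [:: b, c & s].
  rewrite /no_two_plus_two /= (negPf nb2) add0n.
  have [c2|c2] := eqVneq c 2.
    have b1 : b = 1 by lia.
    by have := spaced_nextN sp (mem_head _ _); rewrite b1 c2 !inE.
  rewrite add0n (_ : count _ _ = 0) //; apply/count_memPn/negP => s2.
  have := allP cs _ s2 => c_2; have b1 : b = 1 by lia.
  by have := spaced_nextN sp (mem_head _ _); rewrite b1 !inE s2 !orbT.
by apply/implyP=> /andP[ob /eqP]; lia.
Qed.

Lemma cons2_shift s : spaced_no1_no22 (2 :: map (addn 2) s) = spaced_no1_no22 s.
Proof.
have [s0|s0] := boolP (0 \in s).
  rewrite [RHS]/spaced_no1_no22 /spaced_no22 /any_spaced s0 andbF /=.
  apply/negP=> /andP[/andP[_ +] _]; rewrite /no_two_plus_two /=.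
  rewrite count_map (eq_count (a2 := pred1 0)) // add1n ltnS ltnS leqn0 => /eqP.
  by move/count_memPn; rewrite s0.
have [s1|s1] := boolP (1 \in s).
  rewrite [RHS]/spaced_no1_no22 s1 andbF.
  apply/negP=> /andP[/andP[/andP[sp _] _] _].
  have := spaced_nextN sp (mem_head _ _).
  by rewrite inE (mem_map (@addnI 2) s 1) s1 orbT.
have ge4 : all (leq 4) (map (addn 2) s).
  rewrite all_map; apply/allP => -[|[|y]] //= ys; first by rewrite ys in s0.
  by rewrite ys in s1.
rewrite /spaced_no1_no22 /spaced_no22 /any_spaced spaced_cons // spaced_shift //.
have -> : 0 \notin 2 :: map (addn 2) s by rewrite inE /=; apply/mapP=> -[].
have -> : 1 \notin 2 :: map (addn 2) s by rewrite inE /=; apply/mapP=> -[].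
rewrite s0 s1 !andbT; case: (boolP (spaced s)) => //= sp.
have -> : no_two_plus_two (2 :: map (addn 2) s).
  rewrite /no_two_plus_two /= count_map (_ : count _ _ = 0) //.
  by apply/count_memPn.
rewrite andbT; case: s s0 s1 sp {ge4} => [|b [|c s]] s0 s1 sp //=.
  by rewrite /no_two_plus_two /= addn0; case: eqP.
rewrite eqn_add2l oddD /=.
have [sl _ _ _] := and4P sp; have lebc : b <= c by case/andP: sl.
have cs : all (leq c) s.
  by move: sl; rewrite /= (path_sortedE leq_trans) => /and3P[].
have b0 : b != 0 by apply: contra s0 => /eqP->; rewrite mem_head.
have b1 : b != 1 by apply: contra s1 => /eqP->; rewrite mem_head.
case: (eqVneq b 2) => [b2|nb2].
  rewrite /no_two_plus_two b2 /= in sp *.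
  rewrite [2 == c]eq_sym; case: eqP => //= nc.
  rewrite add0n (_ : count _ _ = 0) //; apply/count_memPn/negP => /(allP cs).
  by lia.
have -> : no_two_plus_two [:: b, c & s].
  rewrite /no_two_plus_two /= (negPf nb2) add0n (_ : c == 2 = false); last by lia.
  rewrite add0n (_ : count _ _ = 0) //; apply/count_memPn/negP => /(allP cs).
  by lia.
by apply/implyP=> /andP[ob /eqP]; lia.
Qed.

Lemma cons22_shift s : all (leq 2) s -> spaced [:: 2, 2 & map (addn 4) s] = spaced s.
Proof.
move=> ge2; rewrite spaced_cons2 ?spaced_shift // all_map.
by apply: sub_all ge2 => y /=; lia.
Qed.

Definition count_seqs (P : pred (seq nat)) (n m : nat) : nat :=
  #|[set l : m.-tuple 'I_n.+1 | let s := map val l in (sumn s == n) && P s]|.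

Lemma count_seqs_enum P n m : exists l : seq (seq nat),
  [/\ uniq l, forall s, (s \in l) = [&& size s == m, sumn s == n & P s]
    & count_seqs P n m = size l].
Proof.
pose E := [seq map val t | t : m.-tuple 'I_n.+1].
have uE : uniq E.
  by rewrite map_inj_uniq ?enum_uniq // => t t' /(inj_map val_inj); exact: val_inj.
pose l := [seq s <- E | (sumn s == n) && P s].
exists l; split; first exact: filter_uniq.
  move=> s; rewrite mem_filter andbC [RHS]andbA; case: eqP => [ss|]; rewrite ?andbF //=.
  rewrite !andbT; case: (P s); rewrite ?andbF // !andbT.
  apply/mapP/idP => [[t _ ->]|/eqP szs]; first by rewrite size_map size_tuple.
  have les i : i < m -> nth 0 s i < n.+1.
    move=> ltim; rewrite ltnS -ss sumnE (big_nth 0) szs big_mkord.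
    by rewrite (bigD1 (Ordinal ltim)) //= leq_addr.
  exists [tuple inord (nth 0 s i) : 'I_n.+1 | i < m]; first by rewrite mem_enum.
  apply: (@eq_from_nth _ 0) => [|i]; first by rewrite size_map size_tuple.
  rewrite szs => ltim.
  rewrite (nth_map ord0) ?size_tuple // -[i]/(nat_of_ord (Ordinal ltim)) -tnth_nth tnth_mktuple.
  by rewrite /= inordK // les.
rewrite /count_seqs cardE /l /E filter_map size_map; congr size.
by rewrite /enum_mem -filter_predI; apply: eq_filter => t; rewrite /= !inE andbT.
Qed.

Lemma count_seqs_size P n m (l : seq (seq nat)) : uniq l ->
    (forall s, (s \in l) = [&& size s == m, sumn s == n & P s]) ->
  count_seqs P n m = size l.
Proof.
have [l' [ul' ml' ->]] := count_seqs_enum P n m.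
by move=> ul ml; apply/perm_size/uniq_perm => // s; rewrite ml ml'.
Qed.

Lemma eq_count_seqs (P Q : pred (seq nat)) n m : (forall s, size s = m -> P s = Q s) ->
  count_seqs P n m = count_seqs Q n m.
Proof.
move=> PQ; apply: eq_card => t; by rewrite !inE /= PQ // size_map size_tuple.
Qed.

Lemma count_seqs_split (A : pred (seq nat)) P n m :
  count_seqs P n m =
    count_seqs (fun s => P s && A s) n m + count_seqs (fun s => P s && ~~ A s) n m.
Proof.
rewrite /count_seqs -(cardsID [set t : m.-tuple 'I_n.+1 | A (map val t)]).
congr (_ + _); apply: eq_card => t; rewrite !inE /= ?andbA //.
by rewrite -andbA andbC.
Qed.

(** This turns a way of building the partitions of one class from those of another into
multiplication of their series by q^(w m + e). *)
Lemma count_seqs_shift (f : seq nat -> seq nat) (P Q : pred (seq nat)) w e c n m :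
    injective f -> (forall s, size (f s) = size s + c) ->
    (forall s, sumn (f s) = sumn s + (w * size s + e)) ->
    (forall s, Q s -> P (f s)) ->
    (forall s, P s -> size s = m + c -> exists2 s', Q s' & s = f s') ->
  count_seqs P n (m + c) =
    if w * m + e <= n then count_seqs Q (n - (w * m + e)) m else 0.
Proof.
move=> injf szf smf QP PQ; case: leqP => [len|ltn]; last first.
  rewrite (count_seqs_size (l := [::])) // => s; apply/esym/negP.
  case/and3P=> /eqP szs /eqP ss Ps; have [s' Qs' Es] := PQ s Ps szs.
  move: szs ss ltn; rewrite Es szf smf => /addIn ->; lia.
have [l [ul ml ->]] := count_seqs_enum Q (n - (w * m + e)) m.
rewrite -(size_map f); apply: count_seqs_size; first by rewrite map_inj_uniq.
move=> s; apply/mapP/and3P => [[s']|[/eqP szs /eqP ss Ps]].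
  rewrite ml => /and3P[/eqP szs' /eqP ss' Qs'] ->.
  by rewrite szf smf szs' ss' eqxx subnK // eqxx; split=> //; apply: QP.
have [s' Qs' Es] := PQ s Ps szs; exists s' => //.
move: szs ss; rewrite ml Qs' andbT Es szf smf => /addIn -> <-.
by rewrite addnK !eqxx.
Qed.

Lemma sumn_shift k s : sumn (map (addn k) s) = sumn s + k * size s.
Proof. by elim: s => [|x s IHs] //=; rewrite ?IHs ?muln0 // mulnS; lia. Qed.

Lemma map_addn_inj k : injective (map (addn k)).
Proof. exact/inj_map/addnI. Qed.

Definition count_series (P : pred (seq nat)) (m n : nat) : int := (count_seqs P n m)%:Z.

Lemma count_series0 (P : pred (seq nat)) n : P [::] -> count_series P 0 n = ((1 : {poly int})`_n)%R.
Proof.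
move=> P0; rewrite /count_series coef1.
rewrite (count_seqs_size (l := if n == 0 then [:: [::]] else [::])); try by case: eqP.
move=> s; case: eqP => [->|n0]; case: s => [|x s] //=; rewrite ?inE ?P0 //.
by rewrite eq_sym; case: eqP.
Qed.

Lemma count_series_split (A : pred (seq nat)) P m n : (count_series P m n =
  count_series (fun s => P s && A s) m n + count_series (fun s => P s && ~~ A s) m n)%R.
Proof. by rewrite /count_series (count_seqs_split A) PoszD. Qed.

Lemma count_series_shift (f : seq nat -> seq nat) (P Q : pred (seq nat)) w e c m n :
    injective f -> (forall s, size (f s) = size s + c) ->
    (forall s, sumn (f s) = sumn s + (w * size s + e)) ->
    (forall s, Q s -> P (f s)) ->
    (forall s, P s -> size s = m + c -> exists2 s', Q s' & s = f s') ->
  count_series P (m + c) n = lag (w * m + e) (count_series Q m) n.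
Proof.
move=> injf szf smf QP PQ; rewrite /count_series (count_seqs_shift _ injf szf smf QP PQ).
by case: leqP => [len|ltn]; [rewrite lag_sub | rewrite lag_lt].
Qed.

Lemma count_no22S m n : (count_series spaced_no22 m.+1 n =
  count_series spaced_no1_no22 m.+1 n + lag (2 * m + 1) (count_series spaced_no22 m) n)%R.
Proof.
rewrite (count_series_split (fun s => 1 \notin s)); congr (_ + _)%R.
rewrite -[m.+1]addn1; apply: (count_series_shift (f := fun s => 1 :: map (addn 2) s)).
- by move=> s s' [] /map_addn_inj.
- by move=> s; rewrite /= size_map addn1.
- by move=> s; rewrite /= sumn_shift; lia.
- by move=> s Qs; rewrite cons1_shift Qs inE.
move=> s /andP[Ps]; rewrite negbK => s1 _.
have [l Es ge3] := head1_rest (proj1 (andP Ps)) s1.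
have El := shift_up (all_leqW (isT : 2 <= 3) ge3).
by exists (map (subn^~ 2) l); rewrite ?El // -cons1_shift El -Es.
Qed.

Lemma count_no1_no22S m n : (count_series spaced_no1_no22 m.+1 n =
  lag (2 * m.+1) (count_series any_spaced m.+1) n
  + lag (2 * m + 2) (count_series spaced_no1_no22 m) n)%R.
Proof.
rewrite (count_series_split (fun s => 2 \notin s)); congr (_ + _)%R.
  rewrite -[m.+1 in LHS]addn0 -[2 * m.+1]addn0.
  apply: (count_series_shift (f := map (addn 2))).
  - exact: map_addn_inj.
  - by move=> s; rewrite size_map addn0.
  - by move=> s; rewrite sumn_shift addn0.
  - move=> s /andP[sp s0].
    rewrite /spaced_no1_no22 /spaced_no22 /any_spaced spaced_shift // sp /=.
    have N2 : 2 \notin map (addn 2) s by rewrite (mem_map (@addnI 2) s 0).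
    rewrite N2 /no_two_plus_two (count_memPn N2) !andbT.
    by apply/andP; split; apply/mapP=> -[].
  move=> s /andP[/andP[/andP[vs _] s1] s2] _.
  have [sp s0] := andP vs.
  have ge2 : all (leq 2) s.
    apply/allP=> -[|[|y]] // ys; first by rewrite ys in s0.
    by rewrite ys in s1.
  have Es := shift_up ge2; exists (map (subn^~ 2) s) => //.
  rewrite /any_spaced -(@spaced_shift 2) // Es sp /=.
  by rewrite -(mem_map (@addnI 2)) Es.
rewrite -[m.+1]addn1; apply: (count_series_shift (f := fun s => 2 :: map (addn 2) s)).
- by move=> s s' [] /map_addn_inj.
- by move=> s; rewrite /= size_map addn1.
- by move=> s; rewrite /= sumn_shift; lia.
- by move=> s Qs; rewrite cons2_shift Qs inE.
move=> s /andP[Ps]; rewrite negbK => s2 _.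
have [l Es ge4] := head2_rest Ps s2.
have El := shift_up (all_leqW (isT : 2 <= 4) ge4).
by exists (map (subn^~ 2) l); rewrite ?El // -cons2_shift El -Es.
Qed.

Lemma count_spaced22 (P : pred (seq nat)) m n :
    (forall s, P s -> any_spaced s && ~~ no_two_plus_two s) ->
    (forall s, any_spaced s && ~~ no_two_plus_two s -> P s) ->
  count_series P m.+2 n = lag (4 * m + 4) (count_series spaced_no1 m) n.
Proof.
move=> PE EP; rewrite -[m.+2]addn2.
apply: (count_series_shift (f := fun s => [:: 2, 2 & map (addn 4) s])).
- by move=> s s' [] /map_addn_inj.
- by move=> s; rewrite /= size_map addn2.
- by move=> s; rewrite /= sumn_shift; lia.
- move=> s /andP[vs s1]; apply: EP; have [sp s0] := andP vs.
  rewrite /any_spaced cons22_shift ?sp /=; last first.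
    apply/allP=> -[|[|y]] // ys; first by rewrite ys in s0.
    by rewrite ys in s1.
  by rewrite !inE andbT; apply/mapP=> -[].
move=> s /PE/andP[vs n22] _; have [l Es ge6] := head22_rest vs n22.
have El := shift_up (all_leqW (isT : 4 <= 6) ge6).
exists (map (subn^~ 4) l); rewrite ?El //.
have [sp _] := andP vs; rewrite /spaced_no1 /any_spaced -(mem_map (@addnI 4) _ 0) -(mem_map (@addnI 4) _ 1) El.
have ge2 : all (leq 2) (map (subn^~ 4) l).
  by rewrite all_map; apply: sub_all ge6 => y /= ge6; rewrite ltn_subRL.
rewrite -cons22_shift // El -Es sp /=.
by apply/andP; split; apply/negP=> /(allP ge6).
Qed.

Lemma count_anySS m n : (count_series any_spaced m.+2 n =
  count_series spaced_no22 m.+2 n + lag (4 * m + 4) (count_series spaced_no1 m) n)%R.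
Proof.
rewrite (count_series_split no_two_plus_two); congr (_ + _)%R.
exact: count_spaced22.
Qed.

Lemma count_no1SS m n : (count_series spaced_no1 m.+2 n =
  count_series spaced_no1_no22 m.+2 n + lag (4 * m + 4) (count_series spaced_no1 m) n)%R.
Proof.
rewrite (count_series_split no_two_plus_two); congr (_ + _)%R.
  by congr Posz; apply: eq_count_seqs => s _; rewrite /spaced_no1 andbAC.
apply: count_spaced22 => s; first by case/andP=> /andP[-> _] ->.
case/andP=> vs n22; rewrite n22 /spaced_no1 vs andbT /=.
have [l Es _] := head22_rest vs n22; apply: contraTN isT => s1.
by have := spaced_nextN (proj1 (andP vs)) s1; rewrite Es mem_head.
Qed.

Lemma count_any1 n : count_series any_spaced 1 n = count_series spaced_no22 1 n.
Proof.
congr Posz; apply: eq_count_seqs => -[|x [|]] //= _.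
by rewrite /spaced_no22 /no_two_plus_two /= addn0; case: eqP; rewrite andbT.
Qed.

Lemma count_no1_1 n : count_series spaced_no1 1 n = count_series spaced_no1_no22 1 n.
Proof.
congr Posz; apply: eq_count_seqs => -[|x [|]] //= _.
rewrite /spaced_no1_no22 /spaced_no22 /no_two_plus_two /= addn0.
by case: (x == 2); rewrite andbT.
Qed.

Local Open Scope ring_scope.
Local Notation q := (('X : {poly int})%:F : QF).

Lemma fracX_neq0 : q != 0.
Proof. by rewrite tofrac_eq0 polyX_eq0. Qed.

Lemma one_subX_coef0 n : (1 - 'X^(n.+1) : {poly int})`_0 = 1.
Proof. by rewrite coefB coef1 coefXn subr0. Qed.

Lemma one_sub_fracX n : 1 - q ^+ n.+1 != 0.
Proof. by rewrite -tofracXn -tofrac1 -tofracB tofrac_neq0 ?one_subX_coef0. Qed.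

(** The shape of the equation obtained for the partitions with 2+2 excluded: adding 2 to all
parts of one of them is a way to build another. *)
Lemma represents_geometric e (s t : nat -> int) (r : QF) :
    (forall n, s n = lag e.+1 s n + t n) -> represents t r ->
  represents s (r / (1 - q ^+ e.+1)).
Proof.
move=> st tr; rewrite -tofracXn -tofrac1 -tofracB.
apply: represents_div; first exact: one_subX_coef0.
apply: eq_represents tr => n.
transitivity (s n - lag e.+1 s n); first by rewrite st addrC addrK.
rewrite -convolution_Xn -[s n]/(lag 0 s n) -convolution_Xn -sumrB.
by apply: eq_bigr => i _; rewrite coefB mulrBl.
Qed.

(** The system expresses each series by those with fewer parts and, in one case, by itself. *)
Lemma represents_count_series m :
  [/\ represents (count_series spaced_no22 m) (kr1_gf q m),
      represents (count_series spaced_no1_no22 m) (no1_no22_gf q m)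
    & represents (count_series spaced_no1 m) (no1_gf q m)].
Proof.
have q0 := fracX_neq0; have q1 := one_sub_fracX.
have one (P : pred (seq nat)) : P [::] -> represents (count_series P 0) 1.
  move=> P0; rewrite -tofrac1; apply: eq_represents (represents_poly 1) => n.
  by rewrite count_series0.
elim/ltn_ind: m => -[|m] IHm.
  rewrite kr1_gf0 no1_no22_gf0 no1_gf0 //.
  by split; apply: one.
have [IHk IHz IHg] := IHm m (leqnn _).
(* w is the series of the partitions that begin with 2+2 *)
pose w n := if m is m'.+1 then lag (4 * m) (count_series spaced_no1 m') n else 0.
pose wr : QF := if m is m'.+1 then q ^+ (4 * m) * no1_gf q m' else 0.
have w_wr : represents w wr.
  rewrite /w /wr; case: m IHm {IHk IHz IHg w wr} => [|m] IHm.
    by rewrite -tofrac0; apply: eq_represents (represents_poly 0) => n; rewrite coef0.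
  by apply: represents_lag; have [] := IHm m (leqnSn _).
have anyS n : count_series any_spaced m.+1 n = count_series spaced_no22 m.+1 n + w n.
  rewrite /w; case: (m) => [|k]; first by rewrite addr0 count_any1.
  by rewrite count_anySS; congr (_ + lag _ _ _); lia.
have no1S n : count_series spaced_no1 m.+1 n = count_series spaced_no1_no22 m.+1 n + w n.
  rewrite /w; case: (m) => [|k]; first by rewrite addr0 count_no1_1.
  by rewrite count_no1SS; congr (_ + lag _ _ _); lia.
have zE n : count_series spaced_no1_no22 m.+1 n = lag (2 * m + 2)
    (fun n => count_series spaced_no22 m.+1 n + w n + count_series spaced_no1_no22 m n) n.
  rewrite count_no1_no22S lagD -[(2 * m.+1)%N]/(2 * (1 + m))%N mulnDr addnC.
  by congr (_ + _); apply: lag_eq => k _; apply: anyS.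
have rk : represents (count_series spaced_no22 m.+1) (kr1_gf q m.+1).
  rewrite kr1_gf_solved // -/wr addn2.
  pose t n := lag (2 * m).+2 (fun n => w n + count_series spaced_no1_no22 m n) n
    + lag (2 * m + 1) (count_series spaced_no22 m) n.
  apply: (represents_geometric (t := t)) => [n|].
    by rewrite count_no22S zE addn2 /t !lagD !addrA.
  by apply: representsD; apply: represents_lag => //; apply: representsD.
have rz : represents (count_series spaced_no1_no22 m.+1) (no1_no22_gf q m.+1).
  rewrite no1_no22_gfS // -/wr.
  apply: eq_represents (represents_lag _ (representsD (representsD rk w_wr) IHz)).
  by move=> n; rewrite zE.
split=> //; have -> : no1_gf q m.+1 = no1_no22_gf q m.+1 + wr.
  rewrite /wr; case: (m) => [|k]; first by rewrite addr0 no1_gf1.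
  by rewrite no1_gfSS // mulnS addnC.
by apply: eq_represents (representsD rz w_wr) => n; rewrite no1S.
Qed.

Lemma represents_kr1 m : represents (fun n => (kr1 n m)%:Z) (kr1_gf q m).
Proof.
have [rk _ _] := represents_count_series m; apply: eq_represents rk => n.
by congr Posz; apply: eq_count_seqs => s _; rewrite kr1_partitionE.
Qed.

(** * The identity and its positivity *)

Lemma frac_qpoch k n : (qpoch 'X^(k.+1) 'X^(k.+1) n)%:F = qfact (q ^+ k.+1) n.
Proof.
rewrite /qpoch rmorph_prod; apply: eq_bigr => i _.
by rewrite /= -exprS tofracB tofrac1 !tofracXn.
Qed.

Lemma qpoch_coef0 k n : (qpoch 'X^(k.+1) 'X^(k.+1) n)`_0 = 1.
Proof.
rewrite /qpoch; elim: n => [|n IHn]; first by rewrite big_ord0 coef1.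
rewrite big_ord_recr coefM big_ord1 IHn mul1r -exprS -exprM mulSn.
by rewrite one_subX_coef0.
Qed.

Lemma P_comp_walks (m1 m2 m3 m : nat) : P m1 m2 m3 (m%:Z + 1) \Po 'X^2 =
  \sum_(w <- walks (m1 + m2 + 2 * m3) 0 | walk_stats m1 m2 m3 m w) ('X^2) ^+ sumn (walk_parts w).
Proof. by rewrite P_walks rmorph_sum; apply: eq_bigr => w _; rewrite /= comp_Xn_poly. Qed.

Lemma frac_P (m1 m2 m3 m : nat) : (P m1 m2 m3 (m%:Z + 1) \Po 'X^2)%:F =
  \sum_(w <- walks (m1 + m2 + 2 * m3) 0 | walk_stats m1 m2 m3 m w)
    (q ^+ 2) ^+ sumn (walk_parts w).
Proof. by rewrite P_comp_walks rmorph_sum; apply: eq_bigr => w _; rewrite /= !tofracXn. Qed.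

Definition summand_value (N m1 m2 m3 m n12 i j k : nat) : QF :=
  if N == (2 * m1 + 2 * m2 + 5 * m3 + n12 + i + 2 * j + k)%N then
    ((P m1 m2 m3 (m%:Z + 1) \Po 'X^2) *
        'X^(2 * m * n12 + 2 * n12 ^ 2 + i + 4 * j + N ^ 2))%:F /
    (qpoch 'X^2 'X^2 n12 * qpoch 'X^6 'X^6 (m1 + m2 + 2 * m3) *
        qpoch 'X^2 'X^2 i * qpoch 'X^4 'X^4 j)%:F
  else 0.

Lemma denominator_coef0 n12 p i j : (qpoch 'X^2 'X^2 n12 * qpoch 'X^6 'X^6 p *
  qpoch 'X^2 'X^2 i * qpoch 'X^4 'X^4 j)`_0 = 1.
Proof. by rewrite !coef0M (qpoch_coef0 1) (qpoch_coef0 5) (qpoch_coef0 1) (qpoch_coef0 3). Qed.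

Lemma represents_summand N m1 m2 m3 m n12 i j k :
  represents (fun n => summand m1 m2 m3 m n12 i j k n N)
             (summand_value N m1 m2 m3 m n12 i j k).
Proof.
rewrite /summand /mul_tpow /summand_value; case: eqP => [EN|_].
  by rewrite -EN; apply: represents_ps_div; apply: denominator_coef0.
by rewrite -tofrac0; apply: eq_represents (represents_poly 0) => n; rewrite coef0.
Qed.

Lemma summand_valueE N m1 m2 m3 m n12 i j k : summand_value N m1 m2 m3 m n12 i j k =
  (\sum_(w <- walks (m1 + m2 + 2 * m3) 0 | walk_stats m1 m2 m3 m w)
    (q ^+ 2) ^+ sumn (walk_parts w)) *
  (if N == (2 * (m1 + m2 + 2 * m3) + m3 + n12 + i + 2 * j + k)%N then
      q ^+ (2 * m * n12 + 2 * n12 ^ 2 + i + 4 * j + N ^ 2)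
      / (qfact (q ^+ 2) n12 * qfact (q ^+ 6) (m1 + m2 + 2 * m3) * qfact (q ^+ 2) i
         * qfact (q ^+ 4) j)
    else 0).
Proof.
rewrite /summand_value.
have -> : (2 * (m1 + m2 + 2 * m3) + m3 = 2 * m1 + 2 * m2 + 5 * m3)%N by lia.
case: ifP => _; last by rewrite mulr0.
by rewrite tofracM tofracXn frac_P !tofracM !frac_qpoch mulrA.
Qed.

(** For N parts, only indices up to 5N contribute. *)
Definition index_box (B : nat) : seq (nat * nat * nat * nat * nat * nat * nat * nat) :=
  let I := iota 0 B in
  [seq (x, k) | x <- [seq (x, j) | x <- [seq (x, i) | x <- [seq (x, n12) |
    x <- [seq (x, m) | x <- [seq (x, m3) | x <- [seq (m1, m2) | m1 <- I, m2 <- I],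
    m3 <- I], m <- I], n12 <- I], i <- I], j <- I], k <- I].

Lemma index_box_uniq B : uniq (index_box B).
Proof.
have U (T : eqType) (s : seq T) : uniq s -> uniq [seq (x, y) | x <- s, y <- iota 0 B].
  by move=> us; apply: allpairs_uniq; rewrite ?iota_uniq // => -[? ?] [? ?] _ _ [-> ->].
by do 7!apply/U; apply: iota_uniq.
Qed.

Lemma mem_index_box B m1 m2 m3 m n12 i j k :
  ((m1, m2, m3, m, n12, i, j, k) \in index_box B) =
  [&& m1 < B, m2 < B, m3 < B, m < B, n12 < B, i < B, j < B & k < B]%N.
Proof.
have M (T : eqType) (s : seq T) x a :
    ((x, a) \in [seq (y, z) | y <- s, z <- iota 0 B]) = (x \in s) && (a < B)%N.
  apply/allpairsP/andP => [[[y z] [/= ys zB [-> ->]]]|[xs aB]].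
    by move: zB; rewrite mem_iota.
  by exists (x, a); rewrite mem_iota.
by rewrite /index_box !M mem_iota -!andbA.
Qed.

Lemma sum_index_box (R : nmodType) B (f : nat -> nat -> nat -> nat -> nat -> nat -> nat -> nat -> R) :
  \sum_(x <- index_box B) (let: (m1, m2, m3, m, n12, i, j, k) := x in f m1 m2 m3 m n12 i j k) =
  \sum_(m1 <- iota 0 B) \sum_(m2 <- iota 0 B) \sum_(m3 <- iota 0 B) \sum_(m <- iota 0 B)
  \sum_(n12 <- iota 0 B) \sum_(i <- iota 0 B) \sum_(j <- iota 0 B) \sum_(k <- iota 0 B)
    f m1 m2 m3 m n12 i j k.
Proof. by rewrite /index_box !big_allpairs. Qed.

Lemma sum_summand_value B N : (5 * N < B)%N ->
  \sum_(x <- index_box B) (let: (m1, m2, m3, m, n12, i, j, k) := x in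
     summand_value N m1 m2 m3 m n12 i j k) = kr1_gf q N.
Proof.
move=> NB; rewrite sum_index_box (kr1_gf_walks (B := B) one_sub_fracX); last by clear -NB; lia.
rewrite -(sum_walk_stats _ (g := box_term q B N) NB); last exact: box_term_large.
apply: eq_bigr => m1 _; apply: eq_bigr => m2 _; apply: eq_bigr => m3 _; apply: eq_bigr => m _.
rewrite mulr_sumr; apply: eq_bigr => n12 _; rewrite mulr_sumr; apply: eq_bigr => i _.
rewrite mulr_sumr; apply: eq_bigr => j _; rewrite mulr_sumr; apply: eq_bigr => k _.
exact: summand_valueE.
Qed.

Definition nonneg_series (s : nat -> int) : Prop := forall n, 0 <= s n.

(** For d with constant coefficient 1 this says that 1/d has nonnegative coefficients; in this
form it is stable under products at once. *)
Definition positive_inverse (d : {poly int}) : Prop :=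
  forall s, nonneg_series (convolution (fun i => d`_i) s) -> nonneg_series s.

Lemma positive_inverseM d e :
  positive_inverse d -> positive_inverse e -> positive_inverse (d * e).
Proof.
move=> pd pe s des; apply/pe/pd => n.
have := des n; rewrite -convolutionA.
by rewrite (eq_convolution (f' := convolution (fun i => d`_i) (fun i => e`_i)) (g' := s)) // => i; rewrite /convolution coefM.
Qed.

Lemma positive_inverse_qpoch k n : positive_inverse (qpoch 'X^(k.+1) 'X^(k.+1) n).
Proof.
rewrite /qpoch; elim: n => [|n IHn].
  rewrite big_ord0 => s + m => /(_ m); rewrite /convolution big_ord_recl coef1 mul1r subn0.
  by rewrite big1 ?addr0 // => i _; rewrite coef1 mul0r.
rewrite big_ord_recr; apply: positive_inverseM => // s sp.
have sE m : convolution (fun i => (1 - 'X^(k.+1) * 'X^(k.+1) ^+ n : {poly int})`_i) s m =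
    s m - lag (k.+1 * n.+1) s m.
  rewrite -[s m in RHS]/(lag 0 s m) -!convolution_Xn -sumrB.
  by apply: eq_bigr => i _; rewrite -exprS -exprM coefB mulrBl.
elim/ltn_ind=> m IHm; have := sp m; rewrite sE subr_ge0; apply: le_trans.
have [lt|le] := ltnP m (k.+1 * n.+1); first by rewrite lag_lt.
by rewrite lag_sub //; apply: IHm; clear -le; lia.
Qed.

Lemma P_coef_ge0 m1 m2 m3 (m : int) w : 0 <= (P m1 m2 m3 (m + 1))`_w.
Proof.
rewrite /P addrK; case: ifP => _.
  by case: ifP => _; rewrite ?coef1 ?coef0 //; case: eqP.
case: m => [m|m]; last by rewrite coef0.
rewrite coef_sum; apply: sumr_ge0 => b _; rewrite coefXn; exact: ler0n.
Qed.

Lemma summand_ge0 m1 m2 m3 m n12 i j k n N : 0 <= summand m1 m2 m3 m n12 i j k n N.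
Proof.
rewrite /summand /mul_tpow; case: ifP => // _; move: n.
suff : positive_inverse (qpoch 'X^2 'X^2 n12 * qpoch 'X^6 'X^6 (m1 + m2 + 2 * m3) *
    qpoch 'X^2 'X^2 i * qpoch 'X^4 'X^4 j).
  apply=> n; rewrite -[X in 0 <= X]/(\sum_(_ < _) _) ps_divP ?denominator_coef0 //.
  rewrite coefMXn; case: ifP => // _; rewrite P_comp_walks coef_sum.
  by apply: sumr_ge0 => w _; rewrite -exprM coefXn ler0n.
by do !apply: positive_inverseM; exact: positive_inverse_qpoch.
Qed.

Theorem theorem5 :
  [/\ formal_sum
        (fun x : nat * nat * nat * nat * nat * nat * nat * nat =>
           let: (m1, m2, m3, m, n12, i, j, k) := x in
           summand m1 m2 m3 m n12 i j k)
        (fun n m => (kr1 n m)%:Z),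
      forall (m1 m2 m3 : nat) (m : int) (w : nat),
        0 <= (P m1 m2 m3 (m + 1))`_w
    & forall m1 m2 m3 m n12 i j k n N : nat,
        0 <= summand m1 m2 m3 m n12 i j k n N].
Proof.
split; [|exact: P_coef_ge0|exact: summand_ge0] => n N.
pose B := (5 * N).+1; exists (index_box B); split; first exact: index_box_uniq.
  case=> [[[[[[[m1 m2] m3] m] n12] i] j] k]; rewrite mem_index_box.
  rewrite /summand /mul_tpow; case: eqP => // EN.
  have [mB|Bm] := ltnP m B; first by rewrite /B EN; clear; lia.
  move=> _; rewrite P_comp_walks big_seq_cond big_pred0 ?mul0r; last first.
    move=> w; apply/negP; rewrite mem_walks => /andP[/andP[/eqP szw wP]].
    case/(walk_stats_bound wP)=> _ _ _; move: Bm; rewrite szw /B EN; clear; lia.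
  by rewrite /ps_div mul0r coef0.
have rx (x : nat * nat * nat * nat * nat * nat * nat * nat) :
    represents (fun n => (let: (m1, m2, m3, m, n12, i, j, k) := x in
                          summand m1 m2 m3 m n12 i j k) n N)
      (let: (m1, m2, m3, m, n12, i, j, k) := x in summand_value N m1 m2 m3 m n12 i j k).
  by case: x => [[[[[[[m1 m2] m3] m] n12] i] j] k]; apply: represents_summand.
have := represents_sum (index_box B) rx; rewrite sum_summand_value // => r.
exact: (represents_inj r (represents_kr1 N) n).
Qed.
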